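(* Let $G$ be a partial graph with a local coloring $\mathsf c$. Suppose that for each $\Omega\in\mathfrak O$ an edge $\mathfrak e(\Omega)$ is selected, with endpoints $\mathfrak l(\Omega)$, a vertex of $\Omega$, and $\mathfrak w(\Omega)$, not a vertex of $\Omega$, such that (H1) $(\mathfrak l(\Omega),\mathsf c(\mathfrak e(\Omega),\mathfrak l(\Omega)))$ is not a cusp-point, and (H2) $(\mathfrak w(\Omega),\mathsf c(\mathfrak e(\Omega),\mathfrak w(\Omega)))$ is a cusp-point. Let $P$ be a set of vertex-color pairs which dominates cusp-points and is disjoint from $P_{out}=\{(\mathfrak l(\Omega),\mathsf c(\mathfrak e(\Omega),\mathfrak l(\Omega)))\mid\Omega\in\mathfrak O\}$. Then for every element $(v,\alpha)$ of $P$ maximal for $\lhd$ restricted to $P$, the vertex $v$ is splitting.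
   Context: A partial graph is a triple $(\mathcal V,\mathcal E,\psi)$ of disjoint finite sets of vertices and edges and a function $\psi$ giving each edge a set of at most two endpoints. A sub-graph is given by $\mathcal V'\subseteq\mathcal V$, $\mathcal E'\subseteq\mathcal E$ with $\psi'(e)=\psi(e)\cap\mathcal V'$; union and inclusion of sub-graphs are componentwise. A path is an alternating sequence $(v_0,e_1,v_1,\dots,e_n,v_n)$ with the endpoints of $e_i$ exactly $v_{i-1}\neq v_i$; simple if edges are pairwise distinct and vertices pairwise distinct except possibly $v_0=v_n$; closed if $v_0=v_n$, open otherwise; a cycle is a simple closed path with at least one edge (viewed as a sub-graph via its vertices and edges). Two vertices are connected if some path joins them; two edges are connected if equal or incident to connected vertices; an edge and a vertex are connected if the edge is incident to a vertex connected to it; a sub-graph is connected if it is non-empty and any two of its elements (vertices or edges) are connected within it. A local coloring $\mathsf c$ assigns a color (in a finite set $\mathsf C$) to each $(e,w)$ with $w$ an endpoint of $e$; vertex-color pairs are elements of $\mathcal V\times\mathsf C$. A cusp is a triple $(e,w,f)$ of distinct edges incident to $w$ with $\mathsf c(e,w)=\mathsf c(f,w)=\alpha$; $(w,\alpha)$ is then a cusp-point. Cusps of a path are consecutive triples that are cusps, plus $(e_n,v_0,e_1)$ for closed paths; cusp-free means none. $\mathfrak O$ is the set of all connected unions of cusp-free cycles of $G$ that are maximal for inclusion among connected unions of cusp-free cycles. A vertex $v$ is splitting if every cycle containing $v$ has a cusp at $v$. Starting color $\mathsf c(e_1,v_0)$, ending color $\mathsf c(e_n,v_n)$. $(v,\alpha)\to_p(u,\beta)$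 means $p$ is a simple open cusp-free path from $v$ to $u$ with starting color not $\alpha$ and ending color $\beta$; $(v,\alpha)\lhd(u,\beta)$ means some such $p$ satisfies: for all vertex $x$, color $\tau$, path $q$ with $(u,\beta)\to_q(x,\tau)$, $x$ does not occur in $p$. $P$ dominates cusp-points if every cusp-point is in $P$ or is $\lhd$ some element of $P$. *)

(* Defs.v *)
From mathcomp Require Import all_boot.

Set Implicit Arguments.
Unset Strict Implicit.
Unset Printing Implicit Defensive.

(* Parallel edges are allowed; an edge may have two, one or no endpoints. *)
Record pgraph := PGraph {
  vert : finType;
  edge : finType;
  ends : edge -> {set vert};
  card_ends : forall e, #|ends e| <= 2
}.

Definition subgraph (G : pgraph) : Type := ({set vert G} * {set edge G})%type.

(* A color is given to every pair (e, w), but [c e w] is only ever used when [w]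
   is an endpoint of [e]; the other values are irrelevant. *)
Definition coloring (G : pgraph) (C : finType) : Type := edge G -> vert G -> C.

Section Paths.
Variable G : pgraph.
Implicit Types (H K : subgraph G) (v w x y : vert G) (e f : edge G).
Implicit Types (p : seq (edge G * vert G)).

Definition whole : subgraph G := ([set: vert G], [set: edge G]).

Definition sub_incl H K : bool := (H.1 \subset K.1) && (H.2 \subset K.2).

Definition union_sub (S : {set {set vert G} * {set edge G}}) : subgraph G :=
  (\bigcup_(K in S) K.1, \bigcup_(K in S) K.2).

Definition ends_in H e : {set vert G} := ends e :&: H.1.

(* The sequence (v_0, e_1, v_1, ..., e_n, v_n) is encoded by the vertex v_0 and
   the list (e_1, v_1) :: ... :: (e_n, v_n) :: nil. *)
Fixpoint is_path H v p : bool :=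
  (v \in H.1) &&
  (if p is (e, w) :: p' then
     [&& e \in H.2, v != w, ends_in H e == [set v; w] & is_path H w p']
   else true).

Definition path_verts v p : seq (vert G) := v :: unzip2 p.
Definition path_edges p : seq (edge G) := unzip1 p.
Definition path_end v p : vert G := last v (unzip2 p).

(* v_0, ..., v_{n-1} are distinct and v_1, ..., v_n are distinct: only v_0 and
   v_n may coincide. *)
Definition simple_path v p : bool :=
  [&& uniq (path_edges p), uniq (belast v (unzip2 p)) & uniq (unzip2 p)].

Definition closed_path v p : bool := path_end v p == v.
Definition open_path v p : bool := ~~ closed_path v p.

Definition is_cycle v p : bool :=
  [&& is_path whole v p, simple_path v p, closed_path v p & p != [::]].

Definition sub_of_path v p : subgraph G :=
  ([set x in path_verts v p], [set e in path_edges p]).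

Definition connected_in H x y : Prop :=
  exists p, is_path H x p /\ path_end x p = y.

Definition connected H : Prop :=
  [/\ H.1 != set0 \/ H.2 != set0,
      forall x y, x \in H.1 -> y \in H.1 -> connected_in H x y,
      forall e f, e \in H.2 -> f \in H.2 ->
        e = f \/ exists x y,
          [/\ x \in ends_in H e, y \in ends_in H f & connected_in H x y]
    & forall e x, e \in H.2 -> x \in H.1 ->
        exists2 y, y \in ends_in H e & connected_in H y x].

End Paths.

Section Cusps.
Variables (G : pgraph) (C : finType) (c : coloring G C).
Implicit Types (H K : subgraph G) (v w : vert G) (e f : edge G).
Implicit Types (p : seq (edge G * vert G)) (x y : vert G * C).

Definition is_cusp (t : edge G * vert G * edge G) : bool :=
  let: (e, w, f) := t in
  [&& e != f, w \in ends e, w \in ends f & c e w == c f w].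

Definition cusp_point x : Prop :=
  exists e f, is_cusp (e, x.1, f) /\ c e x.1 = x.2.

(* The triples (e_i, v_i, e_{i+1}) with 1 <= i < n. *)
Fixpoint inner_triples p : seq (edge G * vert G * edge G) :=
  if p is (e, w) :: p' then
    if p' is (f, _) :: _ then (e, w, f) :: inner_triples p' else [::]
  else [::].

(* For closed paths, (e_n, v_0, e_1) is added. *)
Definition path_triples v p : seq (edge G * vert G * edge G) :=
  inner_triples p ++
  (if p is (e1, v1) :: p' then
     if closed_path v p then [:: ((last (e1, v1) p').1, v, e1)] else [::]
   else [::]).

Definition cusps v p : seq (edge G * vert G * edge G) :=
  [seq t <- path_triples v p | is_cusp t].

Definition cusp_free v p : bool := cusps v p == [::].

Definition cusp_at v p w : bool := has (fun t => t.1.2 == w) (cusps v p).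

Definition splitting w : Prop :=
  forall v p, is_cycle v p -> w \in path_verts v p -> cusp_at v p w.

Definition cusp_free_cycle H : Prop :=
  exists v p, [/\ is_cycle v p, cusp_free v p & H = sub_of_path v p].

Definition connected_union H : Prop :=
  connected H /\
  exists S : {set {set vert G} * {set edge G}},
    (forall K, K \in S -> cusp_free_cycle K) /\ H = union_sub S.

Definition max_connected_union H : Prop :=
  connected_union H /\
  forall K, connected_union K -> sub_incl H K -> K = H.

(* The set \mathfrak O, as a type. *)
Definition max_union : Type := {H : subgraph G | max_connected_union H}.

Definition start_color v p : option C :=
  if p is (e, _) :: _ then Some (c e v) else None.

Definition end_color p : option C :=
  if p is ew :: p' then let: (e, w) := last ew p' in Some (c e w) else None.

(* x ->_p y, where the first vertex of p is that of x. *)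
Definition arrow x p y : Prop :=
  [/\ [/\ is_path (whole G) x.1 p, simple_path x.1 p, open_path x.1 p
        & cusp_free x.1 p],
      path_end x.1 p = y.1,
      start_color x.1 p <> Some x.2
    & end_color p = Some y.2].

Definition lhd x y : Prop :=
  exists2 p, arrow x p y &
    forall z q, arrow y q z -> z.1 \notin path_verts x.1 p.

Definition dominates_cusp_points (P : {set vert G * C}) : Prop :=
  forall x, cusp_point x -> x \in P \/ exists2 y, y \in P & lhd x y.

Definition lhd_maximal_in (P : {set vert G * C}) x : Prop :=
  x \in P /\ forall y, y \in P -> ~ lhd x y.

End Cusps.

(* Main.v *)
(* If v lies in a maximal union Omega, then from (v, a) one can walk inside
   Omega, choosing at each cusp-free cycle the direction that avoids a cusp, up
   to l(Omega) and leave through e(Omega); nothing cusp-free that starts there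
   comes back to Omega, since it would close a cusp-free cycle enlarging Omega.
   Otherwise, if v is not splitting, take a cycle through v without cusp at v
   (and not starting with color a) having as few cusps as possible, and let u be
   its first cusp.  Let Z be Omega if u lies in some Omega, and {u} otherwise;
   P is the part of the cycle before its first visit to Z, R the part after its
   last one.  By minimality, the ends of P and R at Z are cusp-points, hence both
   can be continued out of Z by the same cusp-free path q.  If q met P or R, one
   could shortcut the cycle through q, in one of two ways: one of them has fewer
   cusps, or the complementary cycle is cusp-free and meets Z without lying in
   it.  So q never meets P, and (v, a) is dominated by a cusp-point.  The theorem
   follows as domination is transitive. *)

Require Import Defs.
From mathcomp Require Import all_boot.
From mathcomp Require Import zify.
From Stdlib Require Import Classical.

Set Implicit Arguments.
Unset Strict Implicit.
Unset Printing Implicit Defensive.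

(** * Walks as sequences of darts *)

Section Darts.
Variables (G : pgraph) (C : finType) (c : coloring G C).

(* [(v, e, w)] is the edge [e] traversed from [v] to [w]. *)
Definition dart : Type := (vert G * edge G * vert G)%type.
Implicit Types (d : dart) (s t : seq dart) (a b : vert G * C) (r : rel C).

Definition src d := d.1.1.
Definition edg d := d.1.2.
Definition tgt d := d.2.
Definition flip d : dart := (tgt d, edg d, src d).
Definition sp d := (src d, c (edg d) (src d)).
Definition tp d := (tgt d, c (edg d) (tgt d)).
Definition okd d := (src d != tgt d) && (ends (edg d) == [set src d; tgt d]).

Arguments okd : simpl never.
Arguments sp : simpl never.
Arguments tp : simpl never.

Definition endp a s := last a (map tp s).
Definition verts a s := a.1 :: map tgt s.
Definition rv s := rev (map flip s).

(* The pair [a] records the vertex where the walk starts and the color of the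
   edge by which it was reached; [r] constrains the colors of consecutive edges:
   inequality gives cusp-free walks, the full relation all walks. *)
Fixpoint wk r a s : bool :=
  if s is d :: s' then [&& okd d, a.1 == src d, r a.2 (sp d).2 & wk r (tp d) s']
  else true.

Notation wkn := (wk (fun x y => x != y)).
Notation wkT := (wk (fun _ _ => true)).

(** An immediate backtrack along an edge is counted too, although it is not a cusp;
    [cyc_consecutive] excludes it from the cycles considered. *)
Fixpoint nc a s : nat :=
  if s is d :: s' then (a.2 == (sp d).2) + nc (tp d) s' else 0.

(** Dart form of a simple open cusp-free path whose starting color is not [a.2], or of the empty
    path. *)
Definition pth a s := wkn a s && uniq (verts a s).

(** As [endp a s == a], the color [a.2] is that of the last edge at the base, so the test at the
    first dart is the one for a cusp where the cycle closes. *)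
Definition cfc a s :=
  [&& s != [::], wkn a s, endp a s == a & uniq (map src s)].

Lemma wk_cat r a s t : wk r a (s ++ t) = wk r a s && wk r (endp a s) t.
Proof. by elim: s a => //= d s IH a; rewrite IH -!andbA. Qed.

Lemma endp_cat a s t : endp a (s ++ t) = endp (endp a s) t.
Proof. by rewrite /endp map_cat last_cat. Qed.

Lemma nc_cat a s t : nc a (s ++ t) = nc a s + nc (endp a s) t.
Proof. by elim: s a => //= d s IH a; rewrite IH addnA. Qed.

Lemma wk_cons r a d s :
  wk r a (d :: s) = [&& okd d, a.1 == src d, r a.2 (sp d).2 & wk r (tp d) s].
Proof. by []. Qed.

Lemma nc_cons a d s : nc a (d :: s) = (a.2 == (sp d).2) + nc (tp d) s.
Proof. by []. Qed.

Lemma wk_weak r a s : wk r a s -> wkT a s.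
Proof. by elim: s a => //= d s IH a /and4P[-> -> _ /IH]. Qed.

Lemma wknE a s : wkn a s = wkT a s && (nc a s == 0).
Proof.
elim: s a => //= d s IH a; rewrite IH addn_eq0 eqb0.
case: (okd d) => //=; case: (a.1 == src d) => //=.
by rewrite andbCA.
Qed.

Lemma endp1 a s : (endp a s).1 = last a.1 (map tgt s).
Proof. by elim: s a => //= d s IH a; rewrite /endp /= -/(endp _ _) IH. Qed.

Lemma verts_srcs r a s : wk r a s -> verts a s = rcons (map src s) (endp a s).1.
Proof.
elim: s a => //= d s IH a /and4P[_ /eqP ha _ /IH].
by rewrite /verts /= ha /endp /= => ->.
Qed.

Lemma mem_src_verts r a s y : wk r a s -> y \in map src s -> y \in verts a s.
Proof. by move=> /verts_srcs->; rewrite mem_rcons inE orbC => ->. Qed.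

Lemma mem_end_verts a s : (endp a s).1 \in verts a s.
Proof. by rewrite endp1 mem_last. Qed.

Lemma verts_cat a s t : verts a (s ++ t) = verts a s ++ map tgt t.
Proof. by rewrite /verts map_cat. Qed.

Lemma wk_start r a d s b : wk r a (d :: s) -> b.1 = a.1 -> r b.2 (sp d).2 ->
  wk r b (d :: s).
Proof. by move=> /= /and4P[-> /eqP<- _ ->] -> ->; rewrite eqxx. Qed.

Lemma wk_src r a d s : wk r a (d :: s) -> a.1 = src d.
Proof. by case/and4P=> _ /eqP. Qed.

Lemma wkT_start a b s : a.1 = b.1 -> wkT a s -> wkT b s.
Proof. by case: s => //= d s <-. Qed.

Lemma srcs_rv s : map src (rv s) = rev (map tgt s).
Proof. by rewrite /rv map_rev -map_comp. Qed.

Lemma mem_srcs_rv s y : (y \in map src (rv s)) = (y \in map tgt s).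
Proof. by rewrite srcs_rv mem_rev. Qed.

Lemma mem_tgts_rv s y : (y \in map tgt (rv s)) = (y \in map src s).
Proof. by rewrite /rv map_rev -map_comp mem_rev. Qed.

Lemma okd_flip d : okd d -> okd (flip d).
Proof. by rewrite /okd /= eq_sym setUC. Qed.

(** Reversal swaps arrival and departure colors at each inner vertex, so symmetry of [r] handles
    these; the only new test is the first one, against [b]. *)
Lemma wk_rv r a d s b : symmetric r -> wk r a (d :: s) ->
  b.1 = (endp a (d :: s)).1 -> r b.2 (endp a (d :: s)).2 ->
  wk r b (rv (d :: s)) /\ endp b (rv (d :: s)) = sp d.
Proof.
move=> rC; elim: s a d => [|d2 s IH] a d.
  by rewrite /endp /= => /and4P[/okd_flip-> _ _ _] -> ->; rewrite eqxx.
move=> /= /and4P[okd1 _ _ w2] hb hr.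
have [w e] := IH (tp d) d2 w2 hb hr.
have -> : rv [:: d, d2 & s] = rv (d2 :: s) ++ [:: flip d].
  by rewrite /rv map_cons rev_cons -cats1.
move: w2 => /= /and4P[_ /eqP h1 h2 _].
rewrite wk_cat endp_cat w e; split=> //=; rewrite okd_flip // andbT /=.
by apply/andP; split; [rewrite -[src d2]h1 eqxx | rewrite rC].
Qed.

Lemma head_rv d s a b : exists t d', rv (d :: s) = d' :: t /\ sp d' = endp a (d :: s).
Proof.
elim/last_ind: s => [|s d' _]; first by exists [::], (flip d).
exists (rv (d :: s)), (flip d'); split.
  by rewrite /rv -rcons_cons map_rcons rev_rcons.
by rewrite /endp /= map_rcons last_rcons.
Qed.

Lemma neqC : symmetric (fun x y : C => x != y).
Proof. by move=> x y; rewrite eq_sym. Qed.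

Lemma pth_cat a s t : pth a (s ++ t) ->
  pth a s /\ pth (endp a s) t.
Proof.
rewrite /pth wk_cat verts_cat cat_uniq => /andP[/andP[-> ->] /and3P[-> h u]].
split=> //=; rewrite u andbT; apply: contra h => h; apply/hasP.
by exists (endp a s).1 => //; exact: mem_end_verts.
Qed.

Lemma pth_catI a s t : pth a s -> pth (endp a s) t ->
  (forall y, y \in map tgt t -> y \notin verts a s) -> pth a (s ++ t).
Proof.
rewrite /pth wk_cat verts_cat cat_uniq => /andP[-> ->] /andP[-> /= /andP[_ ->]] h.
by rewrite andbT; apply/hasPn => y /h.
Qed.

Lemma uniq_srcs r a s : wk r a s -> uniq (verts a s) -> uniq (map src s).
Proof. by move=> /verts_srcs->; rewrite rcons_uniq => /andP[]. Qed.

Lemma end_notin_srcs r a s : wk r a s -> uniq (verts a s) ->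
  (endp a s).1 \notin map src s.
Proof. by move=> /verts_srcs->; rewrite rcons_uniq => /andP[]. Qed.

Lemma first_hit r a s (Z : pred (vert G)) : wk r a s -> Z (endp a s).1 ->
  exists s1 s2, [/\ s = s1 ++ s2, forall y, y \in map src s1 -> ~~ Z y
    & Z (endp a s1).1].
Proof.
elim: s a => [|d s IH] a /=; first by exists [::], [::].
move=> /and4P[_ /eqP ha _ ws] hz.
case Za: (Z a.1); first by exists [::], (d :: s).
have [s1 [s2 [-> h1 h2]]] := IH _ ws hz.
exists (d :: s1), s2; split=> // y; rewrite inE => /predU1P[->|/h1//].
by rewrite -ha Za.
Qed.

Lemma last_hit s (Z : pred (vert G)) : has Z (map src s) ->
  exists s1 d s2, [/\ s = s1 ++ d :: s2, Z (src d)
    & forall y, y \in map src s2 -> ~~ Z y].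
Proof.
elim: s => //= d s IH; case hs: (has Z (map src s)).
  by have [s1 [d' [s2 [-> h1 h2]]]] := IH hs; exists (d :: s1), d', s2.
rewrite orbF => Zd; exists [::], d, s; split=> // y hy.
by apply/negP => Zy; move/negP: hs; apply; apply/hasP; exists y.
Qed.

Lemma first_cusp a s : wkT a s -> 0 < nc a s ->
  exists A d B, [/\ s = A ++ d :: B, wkn a A & endp a A = sp d].
Proof.
elim: s a => //= d s IH a /and3P[okd1 /eqP ha ws].
case: eqP => [e _|ne]; first by exists [::], d, s; case: a ha e => ? ? /= -> ->.
rewrite add0n => /(IH _ ws)[A [d' [B [-> wA eA]]]].
by exists (d :: A), d', B; rewrite /= okd1 ha eqxx (introN eqP ne).
Qed.

Lemma okd_edg_eq d1 d2 : okd d1 -> okd d2 -> edg d1 = edg d2 ->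
  src d1 != src d2 -> src d1 = tgt d2 /\ src d2 = tgt d1.
Proof.
move=> /andP[_ /eqP e1] /andP[_ /eqP e2] ee ne.
have eq : [set src d1; tgt d1] = [set src d2; tgt d2] by rewrite -e1 -e2 ee.
have: src d1 \in [set src d2; tgt d2] by rewrite -eq set21.
have: src d2 \in [set src d1; tgt d1] by rewrite eq set21.
by rewrite !inE (negPf ne) eq_sym (negPf ne) /= => /eqP-> /eqP->.
Qed.

Lemma wk_ok r a s d : wk r a s -> d \in s -> okd d.
Proof.
elim: s a => //= d' s IH a /and4P[ok1 _ _ ws].
by rewrite inE => /predU1P[->|/(IH _ ws)].
Qed.

(** An edge met twice from distinct sources is crossed in opposite directions; distinct sources then
    leave only an immediate backtrack, which repeats a color. *)
Lemma uniq_edges a s : wkn a s -> uniq (map src s) -> uniq (map edg s).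
Proof.
elim: s a => //= d s IH a /and4P[ok1 _ _ ws] /andP[hd us].
rewrite (IH _ ws us) andbT; apply/mapP => -[d' d's ee].
have ok' := wk_ok ws d's.
have ne : src d != src d' by apply: contraNneq hd => ->; apply: map_f.
have [e1 e2] := okd_edg_eq ok1 ok' ee ne.
case: s ws us d's {hd IH} => //= d2 s /and4P[_ /eqP h1 h2 _] /andP[h3 _].
rewrite inE => /predU1P[d'2|d's].
  by move: h2; rewrite /sp /= -h1 -d'2 -ee /= eqxx.
by move/negP: h3; apply; rewrite -h1 /= -e2; apply: map_f.
Qed.

Lemma uniq_catI (T : eqType) (s t : seq T) : uniq s -> uniq t ->
  (forall y, y \in s -> y \in t -> False) -> uniq (s ++ t).
Proof.
move=> us ut h; rewrite cat_uniq us ut andbT.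
by apply/hasPn => y yt; apply/negP => ys; exact: h ys yt.
Qed.

Lemma mem_tgts a s y : pth a s -> y \in map tgt s ->
  y = (endp a s).1 \/ (y \in map src s /\ y != a.1).
Proof.
move=> /andP[ws us] ys; move: us (verts_srcs ws).
rewrite /verts /= => /andP[na _] e.
have: y \in a.1 :: map tgt s by rewrite inE ys orbT.
rewrite e mem_rcons inE => /predU1P[->|h]; first by left.
by right; split=> //; apply: contraNneq na => <-.
Qed.

Lemma pth_uniq_tgts a s : pth a s -> uniq (map tgt s).
Proof. by case/andP=> _ /= /andP[]. Qed.

(** * Cycles without cusp at their base, and how detours shorten them *)

Definition good_start al a s :=
  if s is d :: _ then ((sp d).2 != a.2) && ((sp d).2 != al) else false.

(* A cycle at [a.1], closing with color [a.2], without cusp at [a.1] and not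
   starting with color [al]; its other vertices may carry cusps. *)
Definition cyc al a s :=
  [&& good_start al a s, wkT a s, endp a s == a & uniq (map src s)].

(** A backtrack returns to the source of [d1], so by distinctness of sources these two darts are the
    whole cycle, which then starts with the color [a.2] excluded by [good_start]. *)
Lemma cyc_consecutive al a A d1 d2 B :
  cyc al a (A ++ [:: d1, d2 & B]) -> edg d1 != edg d2.
Proof.
case/and4P=> gs ws /eqP ea us; apply/negP => /eqP ee.
have ok1 : okd d1 by apply: (wk_ok ws); rewrite mem_cat !inE eqxx orbT.
have ok2 : okd d2 by apply: (wk_ok ws); rewrite mem_cat !inE eqxx !orbT.
move: us; rewrite map_cat cat_uniq /= !inE !negb_or -!andbA.
case/and5P=> uA n1 n2 nB /and4P[n12 n1B n2B _].
have [e1 e2] := okd_edg_eq ok1 ok2 ee n12.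
move: ws; rewrite wk_cat => /andP[wA] /= /and3P[_ s1 /and3P[_ _ wB]].
case: B => [|d3 B] in n1B nB n2B wB gs ea *; last first.
  by move: n1B; case/and3P: wB => _ /eqP h _; rewrite e1 inE -h eqxx.
have {}ea : a = tp d2 by rewrite -ea endp_cat.
case: A => [|d A] in n1 n2 nB uA wA s1 gs *.
  by move: gs; rewrite /= ea /sp /tp /= ee e1 eqxx.
by move: n1; case/and3P: wA => _ /eqP h _; rewrite /= e1 inE -h ea eqxx.
Qed.

(** Here [n] counts the cusps of a bypassed segment, and [b], [b'] are the tests at its far end
    before and after; a strict increase can only come from [b']. *)
Lemma cusp_count (b b' : bool) m n : n + (b + m) < b' + m -> [/\ b', n = 0 & ~~ b].
Proof. by case: b b' => [] []; split=> //; lia. Qed.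

(* If [x] is on [P = P1 ++ P2], either [P2 ++ d1] is a forbidden cusp-free cycle
   or [P1 ++ rv d2 ++ R] has fewer cusps.  If [x] is on [R = R1 ++ R2], either
   [P ++ d1 ++ R2] has fewer cusps or [R1 ++ rv d2] is forbidden. *)
Lemma detours_shorten al a (P S : seq dart) (r0 : dart) (R : seq dart)
    (Z : pred (vert G)) (x : vert G * C) (d1 d2 : seq dart) :
  cyc al a (P ++ S ++ r0 :: R) -> P != [::] -> wkn a P ->
  nc (tp r0) R < nc (endp a P) (S ++ r0 :: R) ->
  (forall y, y \in map src P -> ~~ Z y) ->
  (forall y, y \in map src S -> Z y) ->
  Z (src r0) -> Z (endp a P).1 ->
  (forall y, y \in map src R -> ~~ Z y) ->
  ~~ Z x.1 -> x.1 \in map src (P ++ S ++ r0 :: R) ->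
  pth (endp a P) d1 -> endp (endp a P) d1 = x ->
  pth (sp r0) d2 -> endp (sp r0) d2 = x ->
  (forall y, y \in map src d1 -> y \in map src (P ++ S ++ r0 :: R) -> Z y) ->
  (forall y, y \in map src d2 -> y \in map src (P ++ S ++ r0 :: R) -> Z y) ->
  (forall b s y, cfc b s -> x.1 \in map src s -> y \in map src s -> ~~ Z y) ->
  exists2 s, cyc al a s & nc a s < nc a (P ++ S ++ r0 :: R).
Proof.
move omE : (P ++ S ++ r0 :: R) => om.
move=> cy Pn wP ncS ZP ZS Zr0 ZeP ZR Zx xom p1 e1 p2 e2 o1 o2 nocfc.
have ncom : nc (tp r0) R < nc a om.
  by rewrite -omE nc_cat (leq_trans ncS) // leq_addl.
case/and4P: cy => gs ws /eqP ea us.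
have [w1 u1] := andP p1; have [w2 u2] := andP p2.
have /andP[ncP0 ncP] : wkT a P && (nc a P == 0) by rewrite -wknE.
have /and3P[_ wS wR] : [&& wkT a P, wkT (endp a P) S
    & wkT (endp (endp a P) S) (r0 :: R)] by rewrite -!wk_cat omE.
have d1n : d1 != [::].
  by apply: contraNneq Zx => d1e; rewrite -e1 d1e.
have d2n : d2 != [::].
  by apply: contraNneq Zx => d2e; rewrite -e2 d2e.
case: d1 d1n => // f0 d1 _ in p1 e1 o1 w1 u1.
case: d2 d2n => // e0 d2 _ in p2 e2 o2 w2 u2.
have omP y : y \in map src P -> y \in map src om.
  by rewrite -omE map_cat mem_cat => ->.
have omR y : y \in map src (r0 :: R) -> y \in map src om.
  by rewrite -omE !map_cat !mem_cat => ->; rewrite !orbT.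
have us1 := uniq_srcs w1 u1; have us2 := uniq_srcs w2 u2.
have se0 : src r0 = src e0 by exact: wk_src w2.
have ce0 : (sp r0).2 != (sp e0).2 by case/and4P: w2.
have usP : uniq (map src P) by move: us; rewrite -omE map_cat cat_uniq => /and3P[].
have usR : uniq (map src (r0 :: R)).
  by move: us; rewrite -omE !map_cat !cat_uniq => /and3P[_ _ /and3P[]].
have dPR y : y \in map src P -> y \in map src (r0 :: R) -> False.
  move=> yP yR; move: us; rewrite -omE map_cat cat_uniq => /and3P[_ /hasPn h _].
  by move: (h y); rewrite map_cat mem_cat yR orbT yP => /(_ isT).
(* The only ways the detour [d2], read backwards, can meet the cycle; the disjointness checks below
   go through these cases. *)
have tg y : y \in map tgt (e0 :: d2) -> [\/ y = x.1, ~~ (y \in map src om)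
    | Z y /\ y != src r0].
  case/(mem_tgts p2)=> [->|[h1 h2]]; first by rewrite e2; constructor 1.
  case yom: (y \in map src om); last by constructor 2.
  by constructor 3; split=> //; apply: o2.
have urv : uniq (map src (rv (e0 :: d2))).
  by rewrite srcs_rv rev_uniq; exact: pth_uniq_tgts p2.
have xtg : x.1 \in map tgt (e0 :: d2) by rewrite -e2 endp1 /= mem_last.
have wRe : wkT (sp e0) (r0 :: R) by apply: (wkT_start _ wR); rewrite (wk_src wR) se0.
have endR b : endp b (r0 :: R) = a by rewrite -[RHS]ea -omE !endp_cat.
have : x.1 \in map src (P ++ S ++ r0 :: R) by rewrite omE.
rewrite !map_cat !mem_cat => /or3P[xP|/ZS|].
- case/mapP: xP => p0 p0P ex.
  have [P1 [P2 eP]] : exists P1 P2, P = P1 ++ p0 :: P2.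
    by case: (splitPr p0P) => P1 P2; exists P1, P2.
  move: (wP); rewrite eP wk_cat => /andP[wP1 wP2].
  have sP1 : (endp a P1).1 = src p0 by exact: wk_src wP2.
  (* The color in which the detours reach [x] decides: if it differs from that of [p0], the rest of
     [P] followed by [d1] closes a cusp-free cycle through [x] and the hub. *)
  case: (eqVneq x.2 (sp p0).2) => cx; last first.
    have wx : wkn x (p0 :: P2) by apply: wk_start wP2 _ cx; rewrite sP1.
    have ex' : endp x (p0 :: P2) = endp a P by rewrite eP endp_cat.
    have cf : cfc x ((p0 :: P2) ++ f0 :: d1).
      apply/and4P; split=> //; first by rewrite wk_cat wx ex' w1.
        by rewrite endp_cat ex' e1.
      rewrite map_cat; apply: uniq_catI us1 _.
        by move: usP; rewrite eP map_cat cat_uniq => /and3P[].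
      move=> y y1 y2; have yP : y \in map src P.
        by rewrite eP map_cat mem_cat y1 orbT.
      by move/negP: (ZP _ yP); apply; apply: o1 (omP _ yP).
    have /negP[] : ~~ Z (src f0); last by rewrite -(wk_src w1).
    apply: nocfc cf _ _; first by rewrite ex map_cat mem_cat /= mem_head.
    by rewrite map_cat mem_cat /= mem_head orbT.
  (* Otherwise [P1] reaches [x] with another color, since [P] has no cusp there, and the reversed
     [d2] can follow it. *)
  have [] := wk_rv (b := endp a P1) neqC w2.
  - by rewrite e2 ex.
  - by rewrite e2 cx; case/and4P: wP2.
  set b := endp a P1 => wrv erv.
  exists (P1 ++ rv (e0 :: d2) ++ r0 :: R).
    apply/and4P; split.
    - move: gs; rewrite -omE eP; case: (P1) => //=.
      have [t [d' [-> h]]] := head_rv e0 d2 (sp r0) x.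
      by rewrite /= -[c (edg d') _]/((sp d').2) h e2 cx.
    - by rewrite !wk_cat (wk_weak wP1) (wk_weak wrv) erv.
    - by rewrite !endp_cat endR.
    - rewrite !map_cat; apply: uniq_catI; last 1 first.
      + move=> y y1; have yP : y \in map src P.
          by rewrite eP map_cat mem_cat y1.
        rewrite mem_cat mem_srcs_rv => /orP[/tg|]; last exact: dPR.
        case=> [yx|/negP|[Zy _]]; [|by apply; apply: omP|by move/negP: (ZP _ yP)].
        move: usP; rewrite eP map_cat cat_uniq => /and3P[_ /hasPn h _].
        by move: (h y); rewrite yx ex /= mem_head -ex -yx y1 => /(_ isT).
      + by move: usP; rewrite eP map_cat cat_uniq => /and3P[].
      + apply: uniq_catI => // y; rewrite mem_srcs_rv => /tg h1 h2.
        case: h1 => [yx|/negP|[Zy ny]]; last 1 first.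
        * by move: h2; rewrite inE (negPf ny) => /ZR /negP.
        * apply: (dPR x.1); rewrite -?yx //.
          by rewrite yx ex eP map_cat mem_cat /= mem_head orbT.
        * by apply; apply: omR.
  have nP1 : nc a P1 = 0.
    by apply/eqP; move: wP1; rewrite wknE => /andP[].
  have nrv : nc b (rv (e0 :: d2)) = 0.
    by apply/eqP; move: wrv; rewrite wknE => /andP[].
  (* The starting color of [d2] is not that of [r0], so its reversal meets [r0] without cusp and
     only the cusps of [R] remain. *)
  by rewrite !nc_cat nP1 nrv erv nc_cons eq_sym (negPf ce0) !add0n.
- by rewrite (negPf Zx).
rewrite /= inE => /predU1P[ex|]; first by move: Zx; rewrite ex Zr0.
case/mapP=> r1 r1R ex.
have [R1 [R2 eR]] : exists R1 R2, R = R1 ++ r1 :: R2.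
  by case: (splitPr r1R) => R1 R2; exists R1, R2.
move: wR; rewrite eR -cat_cons wk_cat => /andP[wR1 wR2].
have sR1 : (endp (tp r0) R1).1 = src r1 by exact: wk_src wR2.
have cy2 : cyc al a (P ++ (f0 :: d1) ++ r1 :: R2).
  apply/and4P; split.
  - by move: gs; rewrite -omE; case: (P) Pn.
  - rewrite !wk_cat ncP0 (wk_weak w1) e1.
    by apply: (wkT_start _ wR2); rewrite sR1 ex.
  - by rewrite !endp_cat -(endR a) eR -cat_cons endp_cat.
  - have r12 y : y \in map src (r1 :: R2) -> y \in map src R.
      by rewrite eR map_cat mem_cat => ->; rewrite orbT.
    have r12' y : y \in map src (r1 :: R2) -> y \in map src (r0 :: R).
      by move=> /r12 h; rewrite map_cons inE h orbT.
    rewrite !map_cat; apply: uniq_catI => //.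
      apply: uniq_catI => //.
        by move: usR; rewrite eR /= map_cat cat_uniq => /and4P[].
      move=> y y1 /[dup] /r12 /ZR /negP h /r12' y2; apply: h.
      by apply: o1 => //; apply: omR.
    move=> y yP; rewrite mem_cat => /orP[y1|/r12']; last exact: dPR yP.
    by move/negP: (ZP _ yP); apply; apply: o1 => //; apply: omP.
have n1 : nc (endp a P) (f0 :: d1) = 0.
  by apply/eqP; move: w1; rewrite wknE => /andP[].
have n2 : nc a (P ++ (f0 :: d1) ++ r1 :: R2) =
    (x.2 == (sp r1).2) + nc (tp r1) R2.
  by rewrite !nc_cat (eqP ncP) n1 e1.
case: (ltnP (nc a (P ++ (f0 :: d1) ++ r1 :: R2)) (nc a om)) => hlt.
  by exists (P ++ (f0 :: d1) ++ r1 :: R2).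
move: hlt ncom; rewrite n2 eR nc_cat /= => hle hlt.
(* Failure of this shortcut forces [R1] to be cusp-free and to reach [x] with a color other than
   that of the detours, so the reversed [d2] closes [r0 :: R1] into a cusp-free cycle. *)
have [/eqP cx nR1 nend] := cusp_count (leq_trans hlt hle).
have [] := wk_rv (b := endp (tp r0) R1) neqC w2.
- by rewrite e2 ex.
- by rewrite e2 cx.
move=> wrv erv.
have cf : cfc (sp e0) ((r0 :: R1) ++ rv (e0 :: d2)).
  apply/and4P; split=> //.
  - have ok0 : okd r0 by case/and3P: wR1.
    have w : wkT (tp r0) R1 by case/and3P: wR1.
    have wn : wkn (tp r0) R1 by rewrite wknE w nR1.
    rewrite wk_cat wrv andbT; apply/and4P; split=> //; first by rewrite se0.
    by rewrite eq_sym.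
  - by rewrite endp_cat erv.
  have r01 y : y \in map src (r0 :: R1) -> y \in map src (r0 :: R).
    by rewrite eR -cat_cons map_cat mem_cat => ->.
  move: usR; rewrite eR -cat_cons map_cat cat_uniq => /and3P[uR1 /hasPn h _].
  rewrite map_cat; apply: uniq_catI => // y y1; rewrite mem_srcs_rv => /tg [].
  - move=> yx; move: (h y); rewrite yx ex /= mem_head -ex -yx => /(_ isT).
    by rewrite -/(map src (r0 :: R1)) y1.
  - by move/negP; apply; apply/omR/r01.
  case=> Zy ny; move: y1; rewrite /= inE (negPf ny) /= => y1.
  have yR : y \in map src R by rewrite eR map_cat mem_cat y1.
  by move/negP: (ZR _ yR).
have /negP[] // : ~~ Z (src r0).
apply: nocfc cf _ _; first by rewrite map_cat mem_cat mem_srcs_rv xtg orbT.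
by rewrite map_cat mem_cat /= mem_head.
Qed.

Lemma is_cusp_darts d1 d2 : okd d1 -> okd d2 -> edg d1 != edg d2 ->
  tgt d1 = src d2 -> is_cusp c (edg d1, tgt d1, edg d2) = ((tp d1).2 == (sp d2).2).
Proof.
move=> /andP[_ /eqP e1] /andP[_ /eqP e2] ne et.
by rewrite /is_cusp ne e1 e2 set22 et set21 /= /tp et.
Qed.

(** Equal arrival and departure pairs give a genuine cusp because consecutive edges of a [cyc] are
    distinct. *)
Lemma cusp_of al a (Q : seq dart) (r0 : dart) (R : seq dart) :
  cyc al a (Q ++ r0 :: R) -> Q != [::] -> endp a Q = sp r0 -> cusp_point c (sp r0).
Proof.
case: (lastP Q) => // Q' f cy _; move: (cy); rewrite cat_rcons => /cyc_consecutive ne.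
rewrite /endp map_rcons last_rcons => e.
case/and4P: cy => _ ws _ _.
have okf : okd f by apply: (wk_ok ws); rewrite mem_cat mem_rcons !inE eqxx.
have okr : okd r0 by apply: (wk_ok ws); rewrite mem_cat !inE eqxx orbT.
have ft : tgt f = src r0 by case: e.
exists (edg f), (edg r0); split; last by rewrite -e.
by rewrite -[(sp r0).1]/(src r0) -ft is_cusp_darts // e.
Qed.

(** * Rerouting a minimal cycle through a hub *)

Section Hub.
Variables (al : C) (a : vert G * C) (P M : seq dart) (r0 : dart) (R : seq dart).
Variable Z : pred (vert G).
Hypotheses (cy : cyc al a (P ++ M ++ r0 :: R)) (Pn : P != [::]) (wP : wkn a P).
Hypothesis ltR : nc (tp r0) R < nc (endp a P) (M ++ r0 :: R).
Hypothesis min_cyc :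
  forall s, cyc al a s -> nc a (P ++ M ++ r0 :: R) <= nc a s.
Hypothesis ZP : forall y, y \in map src P -> ~~ Z y.
Hypothesis ZR : forall y, y \in map src R -> ~~ Z y.
Hypotheses (Zr0 : Z (src r0)) (ZeP : Z (endp a P).1).

Let ncP : nc a P = 0.
Proof. by apply/eqP; move: wP; rewrite wknE => /andP[]. Qed.

(** [P] and the sources of [R] avoid the hub, so a walk inside it can replace [M], which may itself
    leave the hub. *)
Lemma cyc_reroute t : wkT (endp a P) t -> (endp (endp a P) t).1 = src r0 ->
  uniq (map src t) -> (forall y, y \in map src t -> Z y) ->
  src r0 \notin map src t -> cyc al a (P ++ t ++ r0 :: R).
Proof.
move=> wt et ut Zt nt; case/and4P: cy => gs ws ea us.
move: ws us; rewrite !wk_cat !map_cat !cat_uniq => /and3P[_ wM wR].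
case/and3P=> uP dP /and3P[_ _ uR].
apply/and4P; split.
- by move: gs; case: (P) Pn.
- by rewrite !wk_cat (wk_weak wP) wt; apply: (wkT_start _ wR); rewrite (wk_src wR).
- by move: ea; rewrite !endp_cat.
rewrite !map_cat; apply: uniq_catI => //.
  apply: uniq_catI => // y /[dup] yt /Zt Zy; rewrite inE => /predU1P[yr|/ZR/negP//].
  by move: nt; rewrite -yr yt.
move=> y yP; rewrite mem_cat => /orP[/Zt|yR]; first by apply/negP/ZP.
by move/hasPn: dP => /(_ y); rewrite mem_cat yR orbT yP => /(_ isT).
Qed.

(** A cusp-free [t] leaves cusps only at its junction with [r0] and in [R]; without one at the
    junction the count would be that of [R], below the minimum. *)
Lemma reroute t : pth (endp a P) t -> (endp (endp a P) t).1 = src r0 ->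
  (forall y, y \in verts (endp a P) t -> Z y) ->
  [/\ cyc al a (P ++ t ++ r0 :: R), endp (endp a P) t = sp r0,
      nc (tp r0) R < nc (endp a P) (t ++ r0 :: R) &
      nc a (P ++ t ++ r0 :: R) <= nc a (P ++ M ++ r0 :: R)].
Proof.
move=> /andP[wt ut] et Zt.
have cyt : cyc al a (P ++ t ++ r0 :: R).
  apply: (cyc_reroute (wk_weak wt) et (uniq_srcs wt ut)).
    by move=> y yt; apply/Zt/(mem_src_verts wt).
  by rewrite -et; exact: end_notin_srcs wt ut.
have nt : nc (endp a P) t = 0 by apply/eqP; move: wt; rewrite wknE => /andP[].
have ee : endp (endp a P) t = sp r0.
  case: (eqVneq (endp (endp a P) t).2 (sp r0).2) => [e2|ne].
    by move: et e2; case: (endp _ t) => ? ? /= -> ->.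
  have := min_cyc cyt.
  rewrite !nc_cat !nc_cons ncP nt (negPf ne).
  by move: ltR; rewrite nc_cat nc_cons; clear; lia.
split=> //; rewrite !nc_cat ?ncP nt ee nc_cons eqxx; first by lia.
by move: ltR; rewrite nc_cat nc_cons; clear; lia.
Qed.

Lemma reroute_cusp_r t : pth (endp a P) t -> (endp (endp a P) t).1 = src r0 ->
  (forall y, y \in verts (endp a P) t -> Z y) -> cusp_point c (sp r0).
Proof.
move=> pt et Zt; have [cyt ee _ _] := reroute pt et Zt.
apply: (@cusp_of al a (P ++ t) r0 R); rewrite -?catA //; last by rewrite endp_cat.
by case: (P) Pn.
Qed.

(** The mirror case: [t] is walked backwards, and its starting color avoids a cusp at [r0], so
    minimality puts one at the end of [P]. *)
Lemma reroute_cusp_l t : pth (sp r0) t -> (endp (sp r0) t).1 = (endp a P).1 ->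
  (forall y, y \in verts (sp r0) t -> Z y) -> cusp_point c (endp a P).
Proof.
case: t => [|e0 t] pt et Zt.
  (* An empty [t] means that [P] ends at the source of [r0]; rerouting by the empty walk identifies
     the two pairs. *)
  have [] := @reroute [::] => //.
    by move=> y; rewrite inE => /eqP->.
  move=> cy0 e0 _ _; rewrite [endp _ _]e0.
  by apply: cusp_of cy0 Pn e0.
have [wt ut] := andP pt.
have [d' [t' [e' sd']]] : exists d' t', rv (e0 :: t) = d' :: t' /\
    sp d' = endp (sp r0) (e0 :: t).
  by have [t' [d' [? ?]]] := head_rv e0 t (sp r0) a; exists d', t'.
have se0 : src r0 = src e0 by exact: wk_src wt.
have [wr er] : wkT (endp a P) (rv (e0 :: t)) /\
    endp (endp a P) (rv (e0 :: t)) = sp e0.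
  by apply: wk_rv (wk_weak wt) _ _.
have cyt : cyc al a (P ++ rv (e0 :: t) ++ r0 :: R).
  apply: cyc_reroute => //; first by rewrite er.
  - by rewrite srcs_rv rev_uniq; exact: pth_uniq_tgts pt.
  - by move=> y; rewrite mem_srcs_rv => yt; apply: Zt; rewrite inE yt orbT.
  by rewrite mem_srcs_rv; case/andP: ut.
have ee : endp a P = sp d'.
  case: (eqVneq (endp a P).2 (endp (sp r0) (e0 :: t)).2) => [e2|ne].
    rewrite sd'; move: et e2.
    by case: (endp a P) => ? ?; case: (endp _ _) => ? ? /= -> ->.
  have [wr' _] := wk_rv neqC wt (esym et) ne.
  have nr : nc (endp a P) (rv (e0 :: t)) = 0.
    by apply/eqP; move: wr'; rewrite wknE => /andP[].
  have ce : (sp r0).2 != (sp e0).2 by case/and4P: wt.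
  have := min_cyc cyt.
  rewrite !nc_cat !nc_cons ncP nr er [(sp e0).2 == _]eq_sym (negPf ce).
  by move: ltR; rewrite nc_cat nc_cons; clear; lia.
rewrite ee; apply: (@cusp_of al a P d' (t' ++ r0 :: R)) => //.
by rewrite -cat_cons -e'.
Qed.

(** Rerouting through [t] keeps the middle of the cycle inside the hub, so [detours_shorten] applies
    and contradicts minimality. *)
Lemma no_detour (x : vert G * C) (d1 d2 t : seq dart) :
  pth (endp a P) t -> (endp (endp a P) t).1 = src r0 ->
  (forall y, y \in verts (endp a P) t -> Z y) ->
  ~~ Z x.1 ->
  x.1 \in map src P ++ map src R ->
  pth (endp a P) d1 -> endp (endp a P) d1 = x ->
  pth (sp r0) d2 -> endp (sp r0) d2 = x ->
  (forall y, y \in map src d1 -> y \in map src P ++ map src R -> Z y) ->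
  (forall y, y \in map src d2 -> y \in map src P ++ map src R -> Z y) ->
  (forall b s y, cfc b s -> x.1 \in map src s -> y \in map src s -> ~~ Z y) ->
  False.
Proof.
move=> pt et Zt Zx xPR p1 e1 p2 e2 o1 o2 nocfc.
have [cyt _ lt le] := reroute pt et Zt.
have Zt' y : y \in map src t -> Z y.
  by case/andP: pt => wt _ yt; apply: Zt; exact: mem_src_verts wt yt.
have om y : y \in map src (P ++ t ++ r0 :: R) -> Z y \/ y \in map src P ++ map src R.
  rewrite !map_cat !mem_cat => /or3P[->|/Zt'|]; [by right|by left|].
  by rewrite inE => /predU1P[->|->]; [left|right; rewrite orbT].
have [] := @detours_shorten al a P t r0 R Z x d1 d2 cyt Pn wP lt ZP Zt' Zr0 ZeP
  ZR Zx _ p1 e1 p2 e2 _ _ nocfc.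
- move: xPR; rewrite !map_cat !mem_cat inE => /orP[->//|->].
  by rewrite !orbT.
- by move=> y yd /om[//|]; exact: o1.
- by move=> y yd /om[//|]; exact: o2.
by move=> s /min_cyc h1 h2; move: (leq_trans (leq_trans h2 le) h1); rewrite ltnn.
Qed.

End Hub.

(** The dart [u] leaves the first cusp, so [P] is cusp-free, and this cusp lies between the first
    and last visits to [Z], which leaves [R] strictly fewer cusps. If [Z] is [src u] alone, the
    middle is empty because sources are distinct. *)
Lemma hub_split al a (s : seq dart) : cyc al a s -> 0 < nc a s ->
  exists u : dart, src u != a.1 /\ forall Z : pred (vert G), Z (src u) -> ~~ Z a.1 ->
  exists (P M : seq dart) (r0 : dart) (R : seq dart), s = P ++ M ++ r0 :: R /\
    [/\ P != [::], wkn a P & nc (tp r0) R < nc (endp a P) (M ++ r0 :: R)] /\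
    [/\ forall y, y \in map src P -> ~~ Z y,
       forall y, y \in map src R -> ~~ Z y, Z (src r0), Z (endp a P).1 &
       (forall y, Z y -> y = src u) -> endp a P = sp r0].
Proof.
move=> /and4P[gs ws _ us] nz.
have [A [u [B [es wA eA]]]] := first_cusp ws nz.
exists u; split.
  case: A es wA eA => [|h A] es wA eA; first by
    have ea : a = sp u := eA; move: gs; rewrite es ea /= eqxx.
  rewrite (wk_src wA); move: us; rewrite es map_cat => /andP[h1 _].
  by apply: contraNneq h1 => <-; rewrite mem_cat inE eqxx orbT.
move=> Z Zu Za.
have [|P [M1 [eP ZP ZeP]]] := first_hit (Z := Z) wA; first by rewrite eA.
have [|M2 [r0 [R [eR Zr0 ZR]]]] := last_hit (s := u :: B) (Z := Z).
  by rewrite /= Zu.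
exists P, (M1 ++ M2), r0, R; split; first by rewrite es eP eR !catA.
have Pn : P != [::].
  by apply: contraNneq Za => P0; move: ZeP; rewrite P0.
move: wA; rewrite eP wk_cat => /andP[wP wM1]; split; split=> //.
  rewrite -catA nc_cat -eR -endp_cat -eP eA nc_cons eqxx.
  suff : nc (tp r0) R <= nc (tp u) B by clear; lia.
  case: M2 eR => [|m M2] [-> ->] //; rewrite nc_cat nc_cons; clear; lia.
move=> Z1; have := us; rewrite es eP -catA map_cat cat_uniq => /and3P[_ _ uq].
have sr0 := Z1 _ Zr0; have sP := Z1 _ ZeP.
have M10 : M1 = [::].
  case: M1 eP wM1 uq => // m M1 eP wM1 uq; have sm := wk_src wM1.
  by move: uq; rewrite cat_cons map_cons -sm sP map_cat cons_uniq mem_cat inE eqxx orbT.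
move: uq; rewrite M10 => /= /andP[nu _]; case: M2 eR => [|m M2] [e1 e2].
  by move: eA; rewrite eP M10 cats0 e1.
by move: nu; rewrite e2 map_cat mem_cat inE sr0 eqxx orbT.
Qed.

(** * Correspondence between dart walks and paths *)

Fixpoint dts v (p : seq (edge G * vert G)) : seq dart :=
  if p is (e, w) :: p' then (v, e, w) :: dts w p' else [::].

Definition und s := [seq (edg d, tgt d) | d <- s].

Lemma und_dts v p : und (dts v p) = p.
Proof. by elim: p v => //= -[e w] p IH v; rewrite /= IH. Qed.

Lemma unzip2_und s : unzip2 (und s) = map tgt s.
Proof. by rewrite /unzip2 /und -map_comp. Qed.

Lemma unzip1_und s : unzip1 (und s) = map edg s.
Proof. by rewrite /unzip1 /und -map_comp. Qed.

(** An edge has at most two endpoints, so two distinct ones inside [H] are all of them. *)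
Lemma is_path_und (H : subgraph G) a s : is_path H a.1 (und s) ->
  wkT a (dts a.1 (und s)).
Proof.
have e2 (A : {set vert G}) x y : x != y -> #|A| <= 2 -> [set x; y] \subset A ->
    A = [set x; y].
  by move=> ne cA sA; apply/esym/eqP; rewrite eqEcard sA cards2 ne.
move: (und s) => p; elim: p a => //= -[e w] p IH a /and5P[_ _ ne /eqP eq pp].
rewrite /= /okd /= eqxx ne /= (IH (tp (a.1, e, w))) // andbT.
apply/eqP/e2 => //; first exact: card_ends.
by rewrite -eq subsetIl.
Qed.

Lemma und_is_path (H : subgraph G) a s : wkT a s -> a.1 \in H.1 ->
  (forall d, d \in s -> edg d \in H.2 /\ tgt d \in H.1) -> is_path H a.1 (und s).
Proof.
elim: s a => [|d s IH] a /= ws aH hs; first by rewrite aH.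
case/and3P: ws => /andP[ne /eqP ed] /eqP ea ws.
have [dH tH] := hs d (mem_head _ _).
rewrite aH dH ea ne (IH (tp d)) //=; last first.
  by move=> d' d's; apply: hs; rewrite inE d's orbT.
rewrite andbT /ends_in ed; apply/eqP/setIidPl/subsetP => y.
by rewrite !inE => /orP[]/eqP-> //; rewrite -ea.
Qed.

(** A cusp asks for distinct edges while [wkn] compares colors only; distinctness of all edges
    closes the gap. *)
Lemma wkn_inner a d s : wkT a (d :: s) -> uniq (map edg (d :: s)) ->
  wkn (tp d) s = all (predC (is_cusp c)) (inner_triples (und (d :: s))).
Proof.
elim: s a d => [|d2 s IH] a d //.
move=> /and4P[ok1 _ _ w2] u; move: (w2) => /and4P[ok2 /eqP e2 _ _].
have u2 : uniq (map edg (d2 :: s)) by case/andP: u.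
have ne : edg d != edg d2 by move: u; rewrite /= inE negb_or => /andP[/andP[]].
transitivity (~~ is_cusp c (edg d, tgt d, edg d2) && wkn (tp d2) s).
  by rewrite is_cusp_darts // wk_cons ok2 e2 eqxx.
by rewrite (IH _ _ w2 u2).
Qed.

Lemma belast_tgts r a s : wk r a s -> belast a.1 (map tgt s) = map src s.
Proof. by elim: s a => //= d s IH a /and4P[_ /eqP<- _ /IH->]. Qed.

Lemma endp_eq1 a s : path_end a.1 (und s) = (endp a s).1.
Proof. by rewrite /path_end unzip2_und endp1. Qed.

Lemma end_color_und a d s : end_color c (und (d :: s)) = Some (endp a (d :: s)).2.
Proof.
rewrite /= /endp /=; elim: s d => //= d2 s IH d; exact: IH.
Qed.

Lemma cusp_freeE v p : cusp_free c v p = all (predC (is_cusp c)) (path_triples v p).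
Proof.
rewrite /cusp_free /cusps -[LHS]negbK -has_filter -all_predC.
by apply: eq_all.
Qed.

Lemma pth_arrow x s : s != [::] -> pth x s ->
  arrow c x (und s) (endp x s) /\ path_verts x.1 (und s) = verts x s.
Proof.
case: s => // d s _ /[dup] p /andP[ws us].
have us' := uniq_srcs ws us.
have ue := uniq_edges ws us'.
have op : open_path x.1 (und (d :: s)).
  apply: contraTneq (us); rewrite endp_eq1 => e.
  by rewrite /verts cons_uniq negb_and negbK -e endp1 /= mem_last.
split; last by rewrite /path_verts unzip2_und.
split; last by rewrite (end_color_und x).
- split=> //.
  + by apply: und_is_path (wk_weak ws) _ _; rewrite ?inE // => d' _; rewrite !inE.
  + rewrite /simple_path /path_edges unzip1_und unzip2_und ue (belast_tgts ws) us'.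
    by case/andP: us.
  rewrite cusp_freeE /path_triples (negPf op) cats0 -(wkn_inner (wk_weak ws) ue).
  by case/and4P: ws.
- exact: endp_eq1.
by case/and4P: ws => _ /eqP /= -> ne _ [e]; rewrite -e eqxx in ne.
Qed.

Lemma arrow_pth x p y : arrow c x p y ->
  exists s, [/\ s != [::], pth x s, endp x s = y & path_verts x.1 p = verts x s].
Proof.
rewrite -{1 2}(und_dts x.1 p); set s := dts x.1 p => -[[ip sm op cf] pe sc ec].
have wT : wkT x s by have := is_path_und ip; rewrite !und_dts.
case es: s => [|d s'] in wT ip sm op cf pe sc ec *; first by [].
have /and3P[] := sm; rewrite /path_edges unzip1_und unzip2_und => ue ub ut.
have vE : path_verts x.1 (und (d :: s')) = verts x (d :: s').
  by rewrite /path_verts unzip2_und.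
move: (op); rewrite /open_path /closed_path endp_eq1 => /negPf op'.
have eE : endp x (d :: s') = y.
  move: ec pe; rewrite (end_color_und x) endp_eq1.
  by case: (endp _ _) y => ? ? [? ?] /= [->] ->.
exists (d :: s'); split=> //; apply/andP; split.
  move: cf; rewrite cusp_freeE /path_triples /open_path (negPf op) cats0.
  rewrite -(wkn_inner wT ue) => wn.
  case/and3P: wT => ok1 /eqP e1 _; rewrite /= ok1 e1 eqxx wn andbT /=.
  by apply/eqP => e; apply: sc; rewrite e /= e1.
rewrite (verts_srcs wT) rcons_uniq -(belast_tgts wT) ub andbT.
rewrite /= inE negb_or op' /=.
move: ut; rewrite endp1 /=; case: (lastP s') => // s2 d2.
rewrite !map_rcons /= last_rcons belast_rcons mem_rcons rcons_uniq !inE !negb_or.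
by rewrite eq_sym => /andP[/andP[-> _] /andP[-> _]].
Qed.

Lemma wk_rot r a A B : wk r a (A ++ B) -> endp a (A ++ B) = a ->
  wk r (endp a A) (B ++ A) /\ endp (endp a A) (B ++ A) = endp a A.
Proof.
by rewrite endp_cat !wk_cat endp_cat => /andP[wA wB] ->; rewrite wA wB.
Qed.

Lemma cfc_at a s y : cfc a s -> y \in map src s ->
  exists b t, [/\ cfc b t, b.1 = y, map src t =i map src s & map edg t =i map edg s].
Proof.
case/and4P=> _ ws /eqP es us /mapP[d ds ->].
case: (splitPr ds) ws es us => A B ws es us.
have [wr er] := wk_rot ws es.
exists (endp a A), ((d :: B) ++ A); split.
- apply/and4P; split=> //; first by rewrite er.
  by rewrite map_cat uniq_catC -map_cat.
- by rewrite (wk_src wr).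
- by move=> z; rewrite !map_cat !mem_cat orbC.
- by move=> z; rewrite !map_cat !mem_cat orbC.
Qed.

Lemma inner_triples_und (A : seq dart) d1 d2 B :
  (edg d1, tgt d1, edg d2) \in inner_triples (und (A ++ [:: d1, d2 & B])).
Proof.
elim: A => [|d [|d' A] IH]; first exact: mem_head.
  by rewrite /= in IH *; rewrite inE IH orbT.
by rewrite /= in IH *; rewrite inE IH orbT.
Qed.

Lemma cycle_dts v p : is_cycle v p -> exists a d s,
  [/\ p = und (d :: s), wkT a (d :: s), endp a (d :: s) = a, a.1 = v &
  [/\ uniq (map src (d :: s)), uniq (map edg (d :: s)) &
    path_triples v p =
      rcons (inner_triples (und (d :: s))) (edg (last d s), v, edg d)]].
Proof.
case/and4P; case: p => // -[e0 w0] p0 ip /and3P[ue ub ut] cl _.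
set d : dart := (v, e0, w0); set s := dts w0 p0; pose a := endp (tp d) s.
have us : (e0, w0) :: p0 = und (d :: s) by rewrite /= und_dts.
have wT0 : wkT (sp d) (d :: s).
  have := @is_path_und (whole G) (sp d) (d :: s); rewrite -us /=; apply.
  exact: ip.
have ea1 : a.1 = v by apply/eqP; rewrite -[a.1](endp_eq1 (sp d) (d :: s)) -us.
exists a, d, s; rewrite us; split=> //.
  by apply: (wkT_start _ wT0); rewrite ea1.
split.
- by rewrite -(belast_tgts wT0) -unzip2_und -us.
- by rewrite -unzip1_und -us.
have el : (last (e0, w0) p0).1 = edg (last d s).
  by case: us => ->; rewrite -[(e0, w0)]/((fun d => (edg d, tgt d)) d) last_map.
by rewrite /path_triples -us cl el cats1.
Qed.

(** A single dart cannot close up, since [okd] forbids loops; longer cycles have distinct edges by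
    hypothesis. *)
Lemma last_cycle a d s : wkT a (d :: s) -> endp a (d :: s) = a ->
  uniq (map edg (d :: s)) ->
  [/\ a = tp (last d s), tgt (last d s) = src d & edg (last d s) != edg d].
Proof.
move=> ws es; have ea : a = tp (last d s) by rewrite -{1}es /endp /= last_map.
have et : tgt (last d s) = src d by rewrite -(wk_src ws) ea.
split=> //; case: s {ea es} ws et H => [|d2 s] /=.
  by case/and3P=> /andP[/eqP ne _] _ _ h; case: ne.
move=> _ _ /andP[h _]; apply: contraNneq h => <-.
exact: (map_f edg (mem_last d2 s)).
Qed.

Lemma is_cusp_last a d s : wkT a (d :: s) -> endp a (d :: s) = a ->
  uniq (map edg (d :: s)) ->
  is_cusp c (edg (last d s), src d, edg d) = (a.2 == (sp d).2).
Proof.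
move=> ws es ue; have [ea et ne] := last_cycle ws es ue.
rewrite -et is_cusp_darts // -?ea //; apply: (wk_ok ws); first exact: mem_last.
exact: mem_head.
Qed.

(** Rotating the cycle to start at [y] turns the absence of cusp at [y] into an inequality between
    closing and starting colors. *)
Lemma noncusp_cycle v p y : is_cycle v p -> y \in path_verts v p ->
  ~~ cusp_at c v p y -> exists a d s, [/\ a.1 = y, wkT a (d :: s),
    endp a (d :: s) = a, uniq (map src (d :: s)) & (sp d).2 != a.2].
Proof.
move=> /cycle_dts[a [d0 [s0 [ep ws es av [us ue tE]]]]] yp /hasPn nc_y.
have {yp} : y \in map src (d0 :: s0).
  move: yp; rewrite /path_verts ep unzip2_und -av -/(verts a (d0 :: s0)).
  rewrite (verts_srcs ws) es mem_rcons inE (wk_src ws) => /predU1P[->|//].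
  exact: mem_head.
case/mapP=> d ds ey; have [A [B eAB]] : exists A B, d0 :: s0 = A ++ d :: B.
  by case: (splitPr ds) => A B; exists A, B.
have sv : src d0 = v by rewrite -av (wk_src ws).
rewrite eAB in ws es us ue; have [] := wk_rot ws es.
rewrite cat_cons => wr er; have uer : uniq (map edg (d :: B ++ A)).
  by rewrite -cat_cons map_cat uniq_catC -map_cat.
exists (endp a A), d, (B ++ A); split=> //; first by rewrite (wk_src wr).
  by rewrite -cat_cons map_cat uniq_catC -map_cat.
have ci := is_cusp_last wr er uer.
apply/negP => /eqP ce; move: ci; rewrite ce eqxx => ci.
have := nc_y (edg (last d (B ++ A)), src d, edg d).
rewrite mem_filter ci ey eqxx /= => /(_ _)/negP; apply=> //.
have [_ et _] := last_cycle wr er uer.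
(* For a trivial rotation the triple at [y] is the closing one of the path, otherwise an inner
   one. *)
rewrite tE mem_rcons inE; case: (lastP A) eAB et => [|A' d'] eAB et.
  by case: eAB => <- <-; rewrite cats0 sv eqxx.
rewrite last_cat last_rcons in et *; rewrite eAB cat_rcons -et.
by rewrite inner_triples_und orbT.
Qed.

Lemma cusp_free_cycle_cfc (H : subgraph G) : cusp_free_cycle c H ->
  exists a s, [/\ cfc a s, H.1 = [set x in map src s] & H.2 = [set x in map edg s]].
Proof.
case=> v [p [/cycle_dts[a [d [s [ep ws es av [us ue tE]]]]] + ->]].
rewrite cusp_freeE tE all_rcons -av (wk_src ws) => /andP[/= ncl].
rewrite -(wkn_inner ws ue) => wn.
exists a, (d :: s); split.
- apply/and4P; split=> //; last by rewrite es.
  rewrite wk_cons wn (wk_src ws) eqxx -(is_cusp_last ws es ue) ncl.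
  by case/and3P: ws => ->.
- apply/setP => z; rewrite !in_set /path_verts ep unzip2_und -(wk_src ws).
  rewrite -/(verts a (d :: s)) (verts_srcs ws) es mem_rcons (wk_src ws) !inE.
  by rewrite orbA orbb.
- by rewrite /path_edges ep unzip1_und.
Qed.

Lemma cfc_cusp_free_cycle a s : cfc a s ->
  cusp_free_cycle c ([set x in map src s], [set x in map edg s]).
Proof.
case: s => // d s /and4P[_ wn /eqP es us].
have ws := wk_weak wn; have ue := uniq_edges wn us.
have vE : path_verts a.1 (und (d :: s)) = rcons (map src (d :: s)) a.1.
  by rewrite /path_verts unzip2_und -/(verts a (d :: s)) (verts_srcs ws) es.
have cl : closed_path a.1 (und (d :: s)) by rewrite /closed_path endp_eq1 es.
exists a.1, (und (d :: s)); split.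
- apply/and4P; split=> //.
    by apply: und_is_path ws _ _; rewrite ?inE // => d' _; rewrite !inE.
  rewrite /simple_path /path_edges unzip1_und unzip2_und ue (belast_tgts ws) us.
  have tE : map tgt (d :: s) = rcons (map src s) a.1.
    by have := congr1 behead vE; rewrite /path_verts unzip2_und.
  by rewrite tE rcons_uniq (wk_src ws).
- rewrite cusp_freeE /path_triples cl all_cat -(wkn_inner ws ue).
  have -> : wkn (tp d) s by case/and4P: wn.
  have ne : a.2 != (sp d).2 by case/and4P: wn.
  have <- : (edg (last d s), src d, edg d) =
      ((last (edg d, tgt d) (und s)).1, a.1, edg d).
    by rewrite (wk_src ws) -[(edg d, tgt d)]/((fun d => (edg d, tgt d)) d) last_map.
  rewrite all_seq1; change (~~ is_cusp c (edg (last d s), src d, edg d)).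
  by rewrite (is_cusp_last ws es ue).
rewrite /sub_of_path vE /path_edges unzip1_und; congr (_, _).
by apply/setP => z; rewrite !inE mem_rcons (wk_src ws) !inE orbA orbb.
Qed.

(** * Connected unions of cusp-free cycles *)

Section Unions.
Implicit Types (H K U : subgraph G).

Lemma is_path_sub H U v p : sub_incl H U -> is_path H v p -> is_path U v p.
Proof.
move=> /andP[/subsetP sV /subsetP sE].
elim: p v => [|[e w] p IH] v /=; first by rewrite !andbT => /sV.
case/and5P=> /sV-> /sE-> ne /eqP eq /IH->; rewrite ne andbT /= eq_sym.
rewrite eqEcard cards2 ne (leq_trans _ (card_ends e)) ?andbT; last first.
  by rewrite subset_leq_card // subsetIl.
by rewrite -eq; apply: setIS; apply/subsetP.
Qed.

Lemma connected_in_sub H U x y : sub_incl H U -> connected_in H x y ->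
  connected_in U x y.
Proof. by move=> sHU [p [/(is_path_sub sHU) pp ee]]; exists p. Qed.

Lemma connected_in_trans H x y z : connected_in H x y -> connected_in H y z ->
  connected_in H x z.
Proof.
case=> p [pp <-] [q [qq <-]]; exists (p ++ q); split; last first.
  by rewrite /path_end /unzip2 map_cat last_cat.
elim: p x pp qq => [|[e w] p IH] x //= /and5P[-> -> -> -> pp] qq /=.
exact: IH.
Qed.

Lemma connected_from U (r : vert G) : r \in U.1 ->
  (forall e, e \in U.2 -> exists2 y, y \in ends e & y \in U.1) ->
  (forall y, y \in U.1 -> connected_in U r y /\ connected_in U y r) -> connected U.
Proof.
move=> rU eU cU; split.
- by left; apply/set0Pn; exists r.
- move=> x y /cU[_ xr] /cU[ry _]; exact: connected_in_trans xr ry.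
- move=> e f /eU[x xe xU] /eU[y yf yU]; right; exists x, y.
  rewrite !inE xe yf xU yU; split=> //.
  by have [_ xr] := cU _ xU; have [ry _] := cU _ yU; exact: connected_in_trans xr ry.
- move=> e x /eU[y ye yU] xU; exists y; first by rewrite inE ye.
  by have [_ yr] := cU _ yU; have [rx _] := cU _ xU; exact: connected_in_trans yr rx.
Qed.

Lemma cfc_connected_in K a s y z : cfc a s -> K.1 = [set x in map src s] ->
  K.2 = [set e in map edg s] -> y \in K.1 -> z \in K.1 -> connected_in K y z.
Proof.
move=> cf K1 K2 yK zK; have yK' := yK; rewrite K1 inE in yK'.
have [b [t [/and4P[_ wt /eqP et ut] by_ s1 s2]]] := cfc_at cf yK'.
have : z \in map src t by rewrite s1; move: zK; rewrite K1 inE.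
case/mapP=> d dt ez; case: (splitPr dt) wt et ut s1 s2 => A B wt et ut s1 s2.
exists (und A); rewrite -by_ endp_eq1; split; last first.
  by move: wt; rewrite wk_cat ez => /andP[_ /wk_src].
move: (wt); rewrite wk_cat => /andP[wA _].
apply: und_is_path (wk_weak wA) _ _; first by rewrite by_.
move=> d' d'A; split.
  by rewrite K2 inE -s2 map_f // mem_cat d'A.
have : tgt d' \in verts b (A ++ d :: B).
  by rewrite inE map_f ?orbT // mem_cat d'A.
rewrite (verts_srcs wt) et mem_rcons inE K1 inE -s1 => /predU1P[->|//].
by rewrite s1 by_.
Qed.

Lemma cfc_end_in K a s e : cfc a s -> K.1 = [set x in map src s] ->
  K.2 = [set e in map edg s] -> e \in K.2 -> exists2 y, y \in ends e & y \in K.1.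
Proof.
move=> /and4P[_ ws _ _] K1 ->; rewrite inE => /mapP[d ds ->].
exists (src d); last by rewrite K1 inE map_f.
by have /andP[_ /eqP->] := wk_ok ws ds; rewrite set21.
Qed.

Lemma mem_union_dart H e : connected_union c H -> e \in H.2 ->
  exists K d, [/\ cusp_free_cycle c K, sub_incl K H, okd d, edg d = e &
    src d \in K.1 /\ tgt d \in K.1].
Proof.
case=> _ [S [cS ->]] /bigcupP[K KS eK].
have [a [s [/and4P[sn ws /eqP es _] K1 K2]]] := cusp_free_cycle_cfc (cS _ KS).
move: eK; rewrite K2 inE => /mapP[d ds ->].
exists K, d; split=> //; first exact: cS.
- apply/andP; split; apply/subsetP => z zK; apply/bigcupP; by exists K.
- exact: wk_ok ws ds.
split; first by rewrite K1 inE map_f.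
have : tgt d \in verts a s by rewrite inE map_f ?orbT.
rewrite (verts_srcs ws) es mem_rcons inE K1 inE => /predU1P[->|//].
by case: s sn ws {es K1 K2 ds} => // d' s _ /wk_src->; exact: mem_head.
Qed.

Lemma union_ends H e x : connected_union c H -> e \in H.2 -> x \in ends e -> x \in H.1.
Proof.
move=> cH eH; have [K [d [_ /andP[/subsetP sK _] /andP[_ /eqP ed] <- [h1 h2]]]] :=
  mem_union_dart cH eH.
by rewrite ed !inE => /orP[]/eqP->; exact: sK.
Qed.

Lemma cfc_connected_union a s : cfc a s ->
  connected_union c ([set x in map src s], [set e in map edg s]).
Proof.
move=> cf; split; last first.
  exists [set ([set x in map src s], [set e in map edg s])]; split.
    by move=> K; rewrite inE => /eqP->; exact: cfc_cusp_free_cycle cf.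
  by rewrite /union_sub !big_set1.
have [r rs] : exists r : vert G, r \in map src s.
  by case/and4P: (cf); case: (s) => // d s' _ _ _ _; exists (src d); exact: mem_head.
apply: (@connected_from _ r); rewrite ?inE //.
  by move=> e; apply: cfc_end_in cf _ _.
have rK : r \in [set x in map src s] by rewrite inE.
by move=> y yK; split; apply: (cfc_connected_in cf).
Qed.

(** Induction on the number of vertices and edges left out, which drops for a strictly larger
    union. *)
Lemma max_above H : connected_union c H ->
  exists2 K, max_connected_union c K & sub_incl H K.
Proof.
have [n] := ubnP ((#|vert G| - #|H.1|) + (#|edge G| - #|H.2|)).
elim: n H => // n IH H lt cH.
case: (classic (exists K, [/\ connected_union c K, sub_incl H K & K <> H]));
    last first.
  move=> h; exists H; last by rewrite /sub_incl !subxx.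
  by split=> // K cK sK; apply: NNPP => ne; apply: h; exists K.
case=> K [cK sHK ne].
have [||L mL sKL] := IH K => //.
  rewrite ltnS in lt; apply: leq_trans lt; case/andP: sHK => s1 s2.
  have l1 := subset_leq_card s1; have l2 := subset_leq_card s2.
  have m1 : #|K.1| <= #|vert G| by exact: max_card.
  have m2 : #|K.2| <= #|edge G| by exact: max_card.
  have : (#|H.1| < #|K.1|) || (#|H.2| < #|K.2|).
    rewrite !ltnNge -negb_and; apply/negP => /andP[h1 h2]; apply: ne.
    have e1 : H.1 == K.1 by rewrite eqEcard s1.
    have e2 : H.2 == K.2 by rewrite eqEcard s2.
    by case: (H) (K) e1 e2 => ? ? [? ?] /= /eqP-> /eqP->.
  move: l1 l2 m1 m2; move: #|H.1| #|K.1| #|H.2| #|K.2| #|vert G| #|edge G|.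
  clear; lia.
exists L => //; case/andP: sHK => s1 s2; case/andP: sKL => t1 t2.
by rewrite /sub_incl (subset_trans s1 t1) (subset_trans s2 t2).
Qed.

(** Adding to [H] a cusp-free cycle that meets it gives a union still connected through the common
    vertex [y]; by maximality this union is [H]. *)
Lemma max_absorb H a s y z : max_connected_union c H -> cfc a s ->
  y \in map src s -> y \in H.1 -> z \in map src s -> z \in H.1.
Proof.
case=> -[cH [S [cS eH]]] mH cf ys yH zs.
pose K : {set vert G} * {set edge G} := ([set x in map src s], [set e in map edg s]).
pose U := union_sub (K |: S).
have cK : cusp_free_cycle c K := cfc_cusp_free_cycle cf.
have cS' K' : K' \in K |: S -> cusp_free_cycle c K'.
  by rewrite in_setU1 => /predU1P[->|/cS].
have sU K' : K' \in K |: S -> sub_incl K' U.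
  move=> K'S; apply/andP; split; apply/subsetP => x xK; apply/bigcupP; by exists K'.
have sKU : sub_incl K U by apply: sU; rewrite in_setU1 eqxx.
have sHU : sub_incl H U.
  rewrite eH; apply/andP; split; apply/subsetP => x /bigcupP[K' K'S xK'].
    by apply/bigcupP; exists K' => //; rewrite in_setU1 K'S orbT.
  by apply/bigcupP; exists K' => //; rewrite in_setU1 K'S orbT.
have yK : y \in K.1 by rewrite inE.
have UE x : x \in U.1 -> x \in K.1 \/ x \in H.1.
  case/bigcupP=> K'; rewrite in_setU1 => /predU1P[->|K'S xK']; first by left.
  by right; rewrite eH; apply/bigcupP; exists K'.
suff <- : U = H by move/andP: sKU => [/subsetP h _]; apply: h; rewrite inE.
apply: (mH _ _ sHU); split; last by exists (K |: S).
apply: (@connected_from _ y).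
- by move/andP: sHU => [/subsetP h _]; apply: h.
- move=> e /bigcupP[K' /[dup] /sU /andP[/subsetP s1 _] /cS' cK' eK'].
  have [a' [s' [cf' h1 h2]]] := cusp_free_cycle_cfc cK'.
  by have [w we wK] := cfc_end_in cf' h1 h2 eK'; exists w => //; exact: s1.
move=> x /UE[xK|xH].
  by split; apply: connected_in_sub sKU _; apply: (cfc_connected_in cf).
case: cH => _ cV _ _.
by split; apply: connected_in_sub sHU _; apply: cV.
Qed.

(** Cut [t] at its first visit to [K]. The two directions of the cycle leave that vertex with
    different colors, so one of them continues [t] without cusp up to [w]. *)
Lemma reach_cycle K x t w : cusp_free_cycle c K -> pth x t ->
  (endp x t).1 \in K.1 -> w \in K.1 ->
  exists t', [/\ pth x t', (endp x t').1 = w,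
    forall y, y \in verts x t' -> y \in verts x t \/ y \in K.1 &
    forall f, f \in map edg t' -> f \in map edg t \/ f \in K.2].
Proof.
move=> /cusp_free_cycle_cfc[a [s [cf K1 K2]]] pt eK wK.
have [t1 [t2 [et ht1 e1K]]] := first_hit (Z := mem K.1) (proj1 (andP pt)) eK.
rewrite et in pt; have [pt1 _] := pth_cat pt.
have v1 y : y \in verts x t1 -> y \in verts x t.
  by rewrite et verts_cat mem_cat => ->.
have f1 f : f \in map edg t1 -> f \in map edg t by rewrite et map_cat mem_cat => ->.
have [wt1 _] := andP pt1.
have e1s : (endp x t1).1 \in map src s by move: e1K; rewrite /= K1 inE.
have [b [q [/and4P[_ wq /eqP eq uq] bE q1 q2]]] := cfc_at cf e1s.
case: (eqVneq w b.1) => [wb|nwb].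
  by exists t1; split=> [//||y /v1|f /f1]; [rewrite wb bE|left|left].
have wsq : w \in map src q by rewrite q1; move: wK; rewrite K1 inE.
case/mapP: wsq => d dq ew.
have [A [B eAB]] : exists A B, q = A ++ d :: B.
  by case: (splitPr dq) => A B; exists A, B.
have {}K1 y : (y \in K.1) = (y \in map src q) by rewrite K1 inE q1.
have {}K2 f : (f \in K.2) = (f \in map edg q) by rewrite K2 inE q2.
rewrite eAB in wq eq uq K1 K2; move: (wq); rewrite wk_cat => /andP[wA wB].
have eA : (endp b A).1 = w by rewrite ew; exact: wk_src wB.
case: A => [|d0 A] in eAB wq eq uq K1 K2 wA wB eA *.
  by rewrite eA eqxx in nwb.
have finish t3 : wkn (endp x t1) t3 -> uniq (verts (endp x t1) t3) ->
    (endp (endp x t1) t3).1 = w ->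
    (forall y, y \in map tgt t3 -> y \in K.1) ->
    (forall f, f \in map edg t3 -> f \in K.2) ->
  exists t', [/\ pth x t', (endp x t').1 = w,
    forall y, y \in verts x t' -> y \in verts x t \/ y \in K.1 &
    forall f, f \in map edg t' -> f \in map edg t \/ f \in K.2].
  move=> w3 u3 e3 vK fK; exists (t1 ++ t3); split.
  - apply: pth_catI => //; first by rewrite /pth w3.
    move=> y y3; rewrite (verts_srcs wt1) mem_rcons inE negb_or; apply/andP; split.
      by case/andP: u3 => h _; apply: contraNneq h => <-.
    by apply/negP => /ht1 /negP; apply; exact: vK.
  - by rewrite endp_cat.
  - by move=> y; rewrite verts_cat mem_cat => /orP[/v1|/vK]; [left|right].
  - by move=> f; rewrite map_cat mem_cat => /orP[/f1|/fK]; [left|right].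
have sb : b.1 = src d0 := wk_src wA.
have vE : verts b (d0 :: A) = rcons (map src (d0 :: A)) w.
  by rewrite (verts_srcs wA) eA.
case: (eqVneq (endp x t1).2 (sp d0).2) => [ce|ne]; last first.
  apply: (finish (d0 :: A)).
  - by apply: wk_start wA _ ne.
  - rewrite /verts -bE -/(verts b (d0 :: A)) vE rcons_uniq ew.
    move: uq; rewrite map_cat cat_uniq => /and3P[-> h _]; rewrite andbT.
    by apply: contra h => h; apply/hasP; exists (src d) => //; exact: mem_head.
  - exact: eA.
  - move=> y yA; rewrite K1 map_cat mem_cat.
    have : y \in verts b (d0 :: A) by rewrite inE yA orbT.
    by rewrite vE mem_rcons inE => /predU1P[->|->//]; rewrite ew /= mem_head orbT.
  - by move=> f fA; rewrite K2 map_cat mem_cat fA.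
have eB : endp (endp b (d0 :: A)) (d :: B) = b by rewrite -endp_cat.
have [] := wk_rv (b := endp x t1) neqC wB.
- by rewrite eB.
- by rewrite eB ce eq_sym; case/and4P: wA.
move=> wr er; apply: (finish (rv (d :: B))) => //.
- rewrite /verts -bE sb cons_uniq mem_tgts_rv /rv map_rev -map_comp rev_uniq.
  move: uq; rewrite map_cat cat_uniq => /and3P[_ h uB]; apply/andP; split=> //.
  by apply: contra h => h; apply/hasP; exists (src d0) => //; exact: mem_head.
- by rewrite er.
- by move=> y; rewrite mem_tgts_rv K1 map_cat mem_cat => ->; rewrite orbT.
move=> f; rewrite /rv map_rev -map_comp mem_rev => fB.
by rewrite K2 map_cat mem_cat fB orbT.
Qed.

(** Induction along a path of [H] from [x.1] to [w]: each edge lies on a cusp-free cycle of the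
    union, and [reach_cycle] moves the end of [t] across it, whatever the color [x.2]. *)
Lemma reach H x w : connected_union c H -> x.1 \in H.1 -> w \in H.1 ->
  exists t, [/\ pth x t, (endp x t).1 = w,
    forall y, y \in verts x t -> y \in H.1 &
    forall f, f \in map edg t -> f \in H.2].
Proof.
move=> cH xH wH; have [[_ cV _ _] _] := cH.
have [p [pp <-]] := cV _ _ xH wH.
have : exists t, [/\ pth x t, (endp x t).1 = x.1,
    forall y, y \in verts x t -> y \in H.1 & forall f, f \in map edg t -> f \in H.2].
  by exists [::]; split=> // y; rewrite inE => /eqP->.
move: pp; move: (x.1) => v; elim: p v => // -[e v'] p IH v /=.
case/and5P=> _ eH ne /eqP ev pp.
case=> t [pt et vt ft]; apply: IH pp _.
have [K [d [cK /andP[/subsetP s1 /subsetP s2] /andP[_ /eqP okd] ed [sd td]]]] :=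
  mem_union_dart cH eH.
have inK y : y \in [set v; v'] -> y \in K.1.
  by rewrite -ev inE -ed okd !inE => /andP[/orP[]/eqP-> _].
have vK : (endp x t).1 \in K.1 by rewrite et inK // set21.
have [t' [pt' et' vt' ft']] := reach_cycle cK pt vK (inK v' (set22 _ _)).
exists t'; split=> // [y /vt'[/vt//|/s1//]|f /ft'[/ft//|/s2//]].
Qed.

End Unions.

(** * Domination in terms of dart walks *)

Lemma verts_prefix r a s y : wk r a s -> y \in verts a s ->
  exists s1 s2, s = s1 ++ s2 /\ (endp a s1).1 = y.
Proof.
move=> ws; rewrite (verts_srcs ws) mem_rcons inE => /predU1P[->|].
  by exists s, [::]; rewrite cats0.
case/mapP=> d ds ->; case: (splitPr ds) ws => s1 s2.
by rewrite wk_cat => /andP[_ /wk_src e]; exists s1, (d :: s2).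
Qed.

Lemma pth_neq_end a s : pth a s -> s != [::] -> (endp a s).1 != a.1.
Proof.
case/andP=> _; rewrite endp1 => /andP[na _].
by case: s na => // d s na _; apply: contraNneq na => <- /=; exact: mem_last.
Qed.

Definition dominated x y :=
  exists2 s, [/\ s != [::], pth x s & endp x s = y] &
    forall q, q != [::] -> pth y q -> (endp y q).1 \notin verts x s.

Lemma lhdP x y : lhd c x y <-> dominated x y.
Proof.
split.
  case=> p /arrow_pth[s [sn ps es vs]] h; exists s => // q qn pq.
  have [aq _] := pth_arrow qn pq; have := h _ _ aq.
  by rewrite vs.
case=> s [sn ps es] h; have [aq vs] := pth_arrow sn ps.
exists (und s); first by rewrite -es.
by move=> z q /arrow_pth[t [tn pt <- _]]; rewrite vs; exact: h.
Qed.

(** Each vertex met after leaving [y] is the end of a prefix, hence avoids [s]; this makes [s ++ t]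
    simple, and it applies to [t ++ q] as well. *)
Lemma dominated_trans y x z : dominated x y -> dominated y z -> dominated x z.
Proof.
case=> s [sn ps es] hs [t [tn pt et] ht].
have disj q : pth y q -> forall u, u \in map tgt q -> u \notin verts x s.
  move=> pq u uq; have [wq uq'] := andP pq.
  have uv : u \in verts y q by rewrite inE uq orbT.
  have [q1 [q2 [eq e1]]] := verts_prefix wq uv.
  rewrite -e1; apply: hs; last by move: pq; rewrite eq => /pth_cat[].
  apply: contraTneq uq' => q10; rewrite cons_uniq negb_and negbK.
  by move: e1; rewrite q10 /= => ->; rewrite uq.
exists (s ++ t); first split.
- by case: (s) sn.
- by apply: pth_catI; rewrite ?es //; exact: disj pt.
- by rewrite endp_cat es.
move=> q qn pq; rewrite verts_cat mem_cat negb_or.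
have nt := ht q qn pq.
apply/andP; split; last by move: nt; rewrite inE negb_or => /andP[].
have yq : pth y (t ++ q).
  apply: pth_catI; rewrite ?et // => u uq.
  have [wq uq'] := andP pq.
  have uv : u \in verts z q by rewrite inE uq orbT.
  have [q1 [q2 [eq e1]]] := verts_prefix wq uv.
  rewrite -e1; apply: ht; last by move: pq; rewrite eq => /pth_cat[].
  apply: contraTneq uq' => q10; rewrite cons_uniq negb_and negbK.
  by move: e1; rewrite q10 /= => ->; rewrite uq.
have := hs (t ++ q); rewrite endp_cat et; apply => //.
by case: (t) tn.
Qed.

(** * Leaving a maximal union through its selected edge *)

Section Exit.
Variables (H : subgraph G) (E : dart).
Hypotheses (mH : max_connected_union c H) (okE : okd E) (srcE : src E \in H.1).
Hypotheses (tgtE : tgt E \notin H.1) (nE : ~ cusp_point c (sp E)).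

Let cH : connected_union c H := proj1 mH.

Lemma exit_color f : okd f -> tgt f = src E -> edg f != edg E ->
  (tp f).2 != (sp E).2.
Proof.
move=> okf et ne; apply/negP => ce; apply: nE; exists (edg f), (edg E).
by rewrite -[(sp E).1]/(src E) -et is_cusp_darts // ce; split=> //; exact/eqP.
Qed.

(** [reach] leads to [src E]. The last edge lies in [H], unlike that of [E], and [sp E] is not a
    cusp-point, so going on along [E] makes no cusp. The condition [b <> sp E] settles the case
    where the walk inside [H] is empty. *)
Lemma exit_path b : b.1 \in H.1 -> b <> sp E ->
  exists t, [/\ pth b (t ++ [:: E]), forall y, y \in verts b t -> y \in H.1 &
    (endp b t).1 = src E].
Proof.
move=> bH nb; have [t [pt et vt ft]] := reach cH bH srcE.
have [wt ut] := andP pt; exists t; split=> //.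
have ce : (endp b t).2 != (sp E).2.
  case: (lastP t) wt et ft => [_ e _|t' f wt et ft].
    apply/eqP => e2; apply: nb; rewrite [b]surjective_pairing.
    by rewrite -[b.1]/(endp b [::]).1 e -[b.2]/(endp b [::]).2 e2.
  move: et; rewrite /endp map_rcons last_rcons => et; apply: exit_color => //.
    by apply: (wk_ok wt); rewrite mem_rcons mem_head.
  apply: contraNneq tgtE => ee; apply: (@union_ends _ (edg f)) => //.
    by apply: ft; rewrite map_rcons mem_rcons mem_head.
  by have /andP[_ /eqP] := okE; rewrite ee => ->; rewrite set22.
apply: pth_catI => //.
  rewrite /pth wk_cons okE et eqxx ce /= et inE /= !andbT.
  by case/andP: okE.
by move=> y; rewrite inE => /eqP->; apply: contra tgtE; exact: vt.
Qed.

(** A first return to [H] could be continued inside [H] up to [E], closing a cusp-free cycle through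
    [tgt E] that meets [H]; [max_absorb] forbids it. *)
Lemma no_return q y : pth (tp E) q -> y \in verts (tp E) q -> y \notin H.1.
Proof.
move=> pq yq; apply/negP => yH.
have [q1 [q2 [eq e1]]] := verts_prefix (proj1 (andP pq)) yq.
have {pq eq} pq1 : pth (tp E) q1 by move: pq; rewrite eq => /pth_cat[].
have [|q3 [q4 [eq3 q3H eq3H]]] := first_hit (Z := mem H.1) (proj1 (andP pq1)).
  by rewrite e1.
have {q1 e1 eq3 pq1} pq3 : pth (tp E) q3 by move: pq1; rewrite eq3 => /pth_cat[].
have [w3 u3] := andP pq3.
(* Returning on another edge with this color would make [sp E] a cusp-point; returning on [E]
   backwards would revisit the start or turn back at once with a cusp. *)
have nb : endp (tp E) q3 <> sp E.
  case: (lastP q3) eq3H w3 u3 {q3H pq3} => [eH|q5 f _ w3 u3].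
    by move: tgtE; rewrite -[tgt E]/(endp (tp E) [::]).1 [_ \in _]eH.
  rewrite /endp map_rcons last_rcons => ef.
  have okf : okd f by apply: (wk_ok w3); rewrite mem_rcons mem_head.
  have et : tgt f = src E by case: ef.
  case: (eqVneq (edg f) (edg E)) => [ee|ne]; last first.
    by have := exit_color okf et ne; rewrite ef eqxx.
  have nes : src f != src E by rewrite -et; case/andP: okf.
  have [es _] := okd_edg_eq okf okE ee nes.
  have := uniq_srcs w3 u3; case: q5 w3 {u3} => [|d q5] w3.
    case/and4P: w3 => _ _ + _; rewrite /sp /tp /= es ee.
    by rewrite eqxx.
  have sd : src d = src f by rewrite es -(wk_src w3).
  by rewrite rcons_cons map_cons cons_uniq sd map_rcons mem_rcons mem_head.
have [t [pt vt et]] := exit_path eq3H nb.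
have q3n : q3 != [::].
  by apply: contraNneq tgtE => q30; move: eq3H; rewrite q30.
have [wt ut] := andP pt.
have cf : cfc (endp (tp E) q3) (t ++ E :: q3).
  apply/and4P; split.
  - by case: (t).
  - by rewrite -cat1s catA wk_cat wt endp_cat.
  - by rewrite endp_cat.
  rewrite -cat1s catA map_cat; apply: uniq_catI (uniq_srcs w3 u3) _.
    exact: uniq_srcs wt ut.
  move=> z; rewrite map_cat mem_cat => /orP[zt|zt] /q3H /negP; apply.
    apply: vt; move: wt; rewrite wk_cat => /andP[wt _]; exact: mem_src_verts wt zt.
  by move: zt; rewrite inE => /eqP->.
have sE : src E \in map src (t ++ E :: q3).
  by rewrite map_cat mem_cat map_cons mem_head orbT.
have tE : tgt E \in map src (t ++ E :: q3).
  case: (q3) q3n w3 => // d q5 _ /wk_src; rewrite [(tp E).1]/= => ->.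
  by rewrite map_cat mem_cat /= !inE eqxx !orbT.
by move: tgtE; rewrite (max_absorb mH cf sE srcE tE).
Qed.

Lemma dominated_exit b : b.1 \in H.1 -> b <> sp E -> dominated b (tp E).
Proof.
move=> bH nb; have [t [pt vt et]] := exit_path bH nb.
exists (t ++ [:: E]); first by split=> //; [case: (t)|rewrite endp_cat].
move=> q qn pq; rewrite verts_cat mem_cat negb_or; apply/andP; split.
  by apply: contra (no_return pq (mem_end_verts _ _)); exact: vt.
by rewrite inE [_ == _](negPf (pth_neq_end pq qn)).
Qed.

End Exit.

(** * A dominating cusp-point for a non-splitting vertex *)

Lemma cyc_exists al v : ~ splitting c v -> exists a s, a.1 = v /\ cyc al a s.
Proof.
move=> ns; have [v0 [p [cy vp ncu]]] :
    exists v0 p, [/\ is_cycle v0 p, v \in path_verts v0 p & ~~ cusp_at c v0 p v].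
  apply: NNPP => h; apply: ns => v0 p cy vp; apply/negPn/negP => ncu.
  by apply: h; exists v0, p.
have [a [d [s [av ws es us ne]]]] := noncusp_cycle cy vp ncu.
case: (eqVneq (sp d).2 al) => [eal|nal]; last first.
  by exists a, (d :: s); split=> //; apply/and4P; split=> //=; rewrite ?ne ?nal ?es.
(* A cycle starting with [al] is reversed: it then starts with its former closing color, which
   differs for want of a cusp at the base. *)
have [] := wk_rv (r := fun _ _ => true) (b := sp d) (fun _ _ => erefl) ws;
  rewrite ?es //; first by rewrite (wk_src ws).
move=> wr er; exists (sp d), (rv (d :: s)); split; first by rewrite -av (wk_src ws).
apply/and4P; split=> //; last 1 first.
- have tE : map tgt (d :: s) = rcons (map src s) (src d).
    by have := congr1 behead (verts_srcs ws); rewrite es (wk_src ws).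
  by rewrite srcs_rv rev_uniq tE rcons_uniq.
- have [t [d' [-> sd]]] := head_rv d s a a.
  by rewrite es in sd; rewrite /good_start sd -eal [a.2 == _]eq_sym ne.
by rewrite er.
Qed.

Lemma cyc_min al a s : cyc al a s ->
  exists2 s', cyc al a s' & forall t, cyc al a t -> nc a s' <= nc a t.
Proof.
have [n] := ubnP (nc a s); elim: n s => // n IH s; rewrite ltnS => lt cs.
case: (classic (exists2 t, cyc al a t & nc a t < nc a s)) => [[t ct h]|h].
  by apply: (IH t) => //; exact: leq_trans h lt.
exists s => // t ct; rewrite leqNgt; apply/negP => h'; apply: h; by exists t.
Qed.

Section Step.
Variables (al : C) (a : vert G * C) (P M : seq dart) (r0 : dart) (R : seq dart).
Variable Z : pred (vert G).
Hypotheses (cy : cyc al a (P ++ M ++ r0 :: R)) (Pn : P != [::]) (wP : wkn a P).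
Hypothesis ltR : nc (tp r0) R < nc (endp a P) (M ++ r0 :: R).
Hypothesis min_cyc :
  forall s, cyc al a s -> nc a (P ++ M ++ r0 :: R) <= nc a s.
Hypothesis ZP : forall y, y \in map src P -> ~~ Z y.
Hypothesis ZR : forall y, y \in map src R -> ~~ Z y.
Hypotheses (Zr0 : Z (src r0)) (ZeP : Z (endp a P).1).

(** [good_start] excludes [al] as well as [a.2], so the base color can be replaced by [al]. *)
Lemma prefix_pth : pth (a.1, al) P /\ endp (a.1, al) P = endp a P.
Proof.
case/and4P: cy => gs _ _ us.
have usP : uniq (map src P) by move: us; rewrite map_cat cat_uniq => /and3P[].
case: P Pn wP gs usP ZP ZeP => // d P' _ wP' /andP[_ nal] usP' ZP' ZeP'.
have w : wkn (a.1, al) (d :: P') by apply: wk_start wP' _ _; rewrite // eq_sym.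
split=> //; rewrite /pth w (verts_srcs w) rcons_uniq usP' andbT.
by apply/negP => /ZP' /negP; apply.
Qed.

(** [X1] and [X2] lead from the two ends at the hub to one pair [B], so [q] continues both. If [q]
    ended on [P], its first visit to [P] or [R] would supply both detours for [no_detour]. *)
Lemma exits_miss_prefix (B : vert G * C) (X1 X2 : seq dart) t q :
  pth (endp a P) t -> (endp (endp a P) t).1 = src r0 ->
  (forall y, y \in verts (endp a P) t -> Z y) ->
  (forall b s y z, cfc b s -> y \in map src s -> z \in map src s -> Z y -> Z z) ->
  pth (endp a P) X1 -> endp (endp a P) X1 = B ->
  pth (sp r0) X2 -> endp (sp r0) X2 = B ->
  (forall y, y \in map src X1 ++ map src X2 -> Z y) ->
  pth B q ->
  (forall y, y \in map tgt q -> y \notin verts (endp a P) X1 ++ verts (sp r0) X2) ->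
  (endp B q).1 \notin map src P.
Proof.
move=> pt et vt nocfc p1 e1 p2 e2 X12 pq disj; apply/negP => qP.
pose W := [pred y | y \in map src P ++ map src R].
have [|q1 [q2 [eq q1W eW]]] := first_hit (Z := W) (proj1 (andP pq)).
  by rewrite /= mem_cat qP.
rewrite eq in pq; have [pq1 _] := pth_cat pq.
have tq y : y \in map tgt q1 -> y \in map tgt q by rewrite eq map_cat mem_cat => ->.
have ZW y : W y -> ~~ Z y by rewrite /= mem_cat => /orP[/ZP|/ZR].
apply: (no_detour cy Pn wP ltR min_cyc ZP ZR Zr0 ZeP (x := endp B q1)
  (d1 := X1 ++ q1) (d2 := X2 ++ q1) pt et vt (ZW _ eW) eW).
- apply: pth_catI; rewrite ?e1 // => y /tq /disj.
  by rewrite mem_cat negb_or => /andP[].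
- by rewrite endp_cat e1.
- apply: pth_catI; rewrite ?e2 // => y /tq /disj.
  by rewrite mem_cat negb_or => /andP[].
- by rewrite endp_cat e2.
- move=> y; rewrite map_cat mem_cat => /orP[h _|/q1W /negP h /h //].
  by apply: X12; rewrite mem_cat h.
- move=> y; rewrite map_cat mem_cat => /orP[h _|/q1W /negP h /h //].
  by apply: X12; rewrite mem_cat h orbT.
move=> b s y cf xs ys; apply: contra (ZW _ eW); exact: nocfc cf ys xs.
Qed.

End Step.

Lemma dominated_cusp_point al v
    (exit_dart : forall H, max_connected_union c H -> exists E, [/\ okd E,
      src E \in H.1, tgt E \notin H.1, ~ cusp_point c (sp E) & cusp_point c (tp E)]) :
  (forall H, max_connected_union c H -> v \notin H.1) -> ~ splitting c v ->
  exists2 y, cusp_point c y & dominated (v, al) y.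
Proof.
move=> + /(cyc_exists al)[a [s0 [av cs0]]]; rewrite -{v}av => nH.
have [s cs smin] := cyc_min cs0.
have in_max b t y : cfc b t -> y \in map src t ->
    exists2 H, max_connected_union c H & y \in H.1.
  move=> cf yt; have [H mH /andP[/subsetP sH _]] := max_above (cfc_connected_union cf).
  by exists H => //; apply: sH; rewrite inE.
(* Otherwise the cycle is cusp-free and puts its base in a maximal union. *)
have ncs : 0 < nc a s.
  rewrite lt0n; apply/negP => nc0; case/and4P: cs => gs ws es us.
  have cf : cfc a s.
    by apply/and4P; split=> //; [case: (s) gs|rewrite wknE ws].
  have [|H mH aH] := in_max _ _ a.1 cf; last by move: (nH _ mH); rewrite aH.
  by case: (s) gs ws => // d t _ /wk_src->; exact: mem_head.
have [u [ua hub]] := hub_split cs ncs.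
case: (classic (exists2 H, max_connected_union c H & src u \in H.1)).
  case=> H mH uH; have cH := proj1 mH.
  have [P [M [r0 [R [es [[Pn wP ltR] [ZP ZR Zr0 ZeP _]]]]]]] :=
    hub (mem H.1) uH (nH _ mH).
  rewrite es in cs smin.
  have [t [pt et vt _]] := reach cH (x := endp a P) ZeP Zr0.
  have [t' [pt' et' vt' _]] := reach cH (x := sp r0) Zr0 ZeP.
  have cr := reroute_cusp_r cs Pn wP ltR smin ZP ZR Zr0 ZeP pt et vt.
  have cl := reroute_cusp_l cs Pn wP ltR smin ZP ZR Zr0 ZeP pt' et' vt'.
  have [E [okE srcE tgtE nE cE]] := exit_dart _ mH.
  (* The hub is [H]. Both ends at it are cusp-points while [sp E] is not, so both can leave through
     [E], with [tp E] as common pair. *)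
  have nl : endp a P <> sp E by move=> e; apply: nE; rewrite -e.
  have nr : sp r0 <> sp E by move=> e; apply: nE; rewrite -e.
  have [t1 [p1 v1 e1]] := exit_path mH okE srcE tgtE nE ZeP nl.
  have [t2 [p2 v2 e2]] := exit_path mH okE srcE tgtE nE (b := sp r0) Zr0 nr.
  have [pP eP] := prefix_pth cs Pn wP ZP ZeP.
  have st b t0 : pth b (t0 ++ [:: E]) -> (forall y, y \in verts b t0 -> y \in H.1) ->
      forall y, y \in map src (t0 ++ [:: E]) -> y \in H.1.
    move=> /andP[+ _] v0 y; rewrite wk_cat map_cat mem_cat => /andP[w0 _].
    case/orP=> [h|]; first by apply: v0; exact: mem_src_verts w0 h.
    by rewrite inE => /eqP->.
  have vE b t0 y : (forall y, y \in verts b t0 -> y \in H.1) ->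
      y \in verts b (t0 ++ [:: E]) -> y \in H.1 \/ y = tgt E.
    move=> v0; rewrite verts_cat mem_cat => /orP[/v0|]; first by left.
    by rewrite inE => /eqP; right.
  have miss q : pth (tp E) q -> (endp (tp E) q).1 \notin map src P.
    move=> pq; apply: (exits_miss_prefix cs Pn wP ltR smin ZP ZR Zr0 ZeP pt et vt _
      p1 _ p2 _ _ pq).
    - by move=> b s1 y z cf ys zs yH; exact: max_absorb mH cf ys yH zs.
    - by rewrite endp_cat.
    - by rewrite endp_cat.
    - by move=> y; rewrite mem_cat => /orP[]; [exact: st p1 v1 y|exact: st p2 v2 y].
    move=> y yq; have yH : y \notin H.1.
      by apply: (no_return mH okE srcE tgtE nE pq); rewrite inE yq orbT.
    have yE : y != tgt E.
      by have /andP[_ /andP[h _]] := pq; apply: contraNneq h => ye; rewrite -[_.1]ye.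
    by rewrite mem_cat negb_or; apply/andP; split; apply/negP => /vE[//|h|h];
      move: yH yE; rewrite h ?eqxx.
  have ends_ne y : y \in map tgt (t1 ++ [:: E]) -> y != (endp a P).1.
    by move=> h; have /andP[_ /andP[h' _]] := p1; apply: contraNneq h' => <-.
  exists (tp E) => //; exists (P ++ t1 ++ [:: E]).
    split; first by case: (P) Pn.
      apply: pth_catI; rewrite ?eP // => y yt.
      have [wP' _] := andP pP; rewrite (verts_srcs wP') mem_rcons inE eP.
      rewrite (negPf (ends_ne _ yt)) /=.
      have /vE[//|yH|->] : y \in verts (endp a P) (t1 ++ [:: E]) by rewrite inE yt orbT.
        by apply: contraTN yH; exact: ZP.
      by have := miss [::]; apply.
    by rewrite !endp_cat.
  move=> q qn pq; have [wP' _] := andP pP.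
  rewrite verts_cat (verts_srcs wP') mem_cat mem_rcons inE !negb_or eP miss // andbT.
  have nH' := no_return mH okE srcE tgtE nE pq (mem_end_verts _ _).
  have nE' := pth_neq_end pq qn.
  apply/andP; split; first by apply: contraNneq nH' => ->.
  apply/negP => h; have : (endp (tp E) q).1 \in verts (endp a P) (t1 ++ [:: E]).
    by rewrite inE h orbT.
  by case/vE=> // h'; [rewrite h' in nH'|rewrite h' eqxx in nE'].
(* The hub is now [src u] alone, and the cusp-point [sp r0], reached by [P], is the dominating
   pair. *)
move=> noH.
have [P [M [r0 [R [es [[Pn wP ltR] [ZP ZR Zr0 ZeP Z1]]]]]]] :=
  hub (pred1 (src u)) (eqxx _) (negbT (introF eqP (nesym (elimN eqP ua)))).
rewrite es in cs smin.
have ePr : endp a P = sp r0 by apply: Z1 => y /eqP.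
have p0 b : pth b [::] by [].
have v0 b y : b.1 = src u -> y \in verts b [::] -> pred1 (src u) y.
  by move=> <-; rewrite inE.
have eu := eqP ZeP; have ru := eqP Zr0.
have er : (endp (endp a P) [::]).1 = src r0 by rewrite ru -eu.
have cr := reroute_cusp_r cs Pn wP ltR smin ZP ZR Zr0 ZeP (p0 _) er
  (fun y => v0 _ y eu).
exists (sp r0) => //.
have [pP eP] := prefix_pth cs Pn wP ZP ZeP.
exists P; first by split=> //; rewrite eP.
case=> // f q _ pq; have [wP' _] := andP pP.
rewrite (verts_srcs wP') mem_rcons inE negb_or eP ePr (pth_neq_end pq) //=.
(* As [endp a P] equals [sp r0], the first dart [f] of the path serves as exit from both sides. *)
have [pf pq'] := pth_cat (s := [:: f]) pq.
have pf' : pth (endp a P) [:: f] by rewrite ePr.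
apply: (exits_miss_prefix cs Pn wP ltR smin ZP ZR Zr0 ZeP (p0 _) er
  (fun y => v0 _ y eu) _ pf' _ pf _ _ pq') => //.
- move=> b s1 y z cf ys zs /eqP yu; case: noH.
  by have [H mH yH] := in_max _ _ _ cf ys; exists H; rewrite -?yu.
- move=> y; rewrite /= !inE orbb => /eqP->.
  by have /andP[/wk_src <- _] := pf.
move=> y yq; rewrite ePr mem_cat orbb.
have /andP[_ u2] := pq; apply: contraL u2 => h.
have : ~~ uniq (verts (sp r0) [:: f] ++ map tgt q).
  by rewrite cat_uniq negb_and; apply/orP; right; rewrite negb_and negbK;
    apply/orP; left; apply/hasP; exists y.
by [].
Qed.

End Darts.

Theorem theorem8p2 (G : pgraph) (C : finType) (c : coloring G C)
  (e : max_union c -> edge G) (l w : max_union c -> vert G)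
  (e_ends : forall Omega, ends (e Omega) = [set l Omega; w Omega])
  (l_in : forall Omega, l Omega \in (sval Omega).1)
  (w_out : forall Omega, w Omega \notin (sval Omega).1)
  (H1 : forall Omega, ~ cusp_point c (l Omega, c (e Omega) (l Omega)))
  (H2 : forall Omega, cusp_point c (w Omega, c (e Omega) (w Omega)))
  (P : {set vert G * C})
  (P_dom : dominates_cusp_points c P)
  (P_out : forall Omega, (l Omega, c (e Omega) (l Omega)) \notin P) :
  forall (v : vert G) (a : C), lhd_maximal_in c P (v, a) -> splitting c v.
Proof.
move=> v a [vP vmax].
pose E Omega : dart G := (l Omega, e Omega, w Omega).
have okE Omega : okd (E Omega).
  apply/andP; split; last by rewrite e_ends.
  by apply: contraNneq (w_out Omega) => lw; rewrite -[w Omega]lw; exact: l_in.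
(* A cusp-point above [(v, a)] is in [P] or below an element of [P]; both contradict maximality, the
   latter by transitivity. *)
have no_dom y : cusp_point c y -> ~ dominated c (v, a) y.
  move=> /P_dom[yP|[z zP /lhdP yz]] vy; first by apply: (vmax y yP); apply/lhdP.
  by apply: (vmax z zP); apply/lhdP; apply: dominated_trans vy yz.
apply: NNPP => ns.
case: (classic (exists2 H, max_connected_union c H & v \in H.1)) => [[H mH vH]|nH].
  pose Omega : max_union c := exist _ H mH.
  apply: (no_dom (tp c (E Omega))); first exact: H2.
  apply: (@dominated_exit _ _ c H (E Omega)) => //.
  - exact: (l_in Omega).
  - exact: (w_out Omega).
  - exact: (H1 Omega).
  (* The starting pair differs from the exit pair, as only the former is in [P]. *)
  by move=> eb; move: (P_out Omega); rewrite -[(_, _)]eb vP.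
have [|H mH|y cy vy] := @dominated_cusp_point _ _ c a v _ _ ns.
- move=> H mH; pose Omega : max_union c := exist _ H mH.
  exists (E Omega); split=> //; [exact: (l_in Omega)|exact: (w_out Omega)|..].
    exact: H1.
  exact: H2.
- by apply/negP => vH; apply: nH; exists H.
exact: no_dom cy vy.
Qed.
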